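(* Let the observations follow the location model described in the context, and let conditions (D1), (S1), (TD1), (TD2), (SD1), (SD2) and (V) of the context hold. Suppose that the alternative hypothesis $$H_1:\ \exists\,k^*\in\{1,\dots,Tm\}\ \text{such that}\ \boldsymbol\mu_1=\cdots=\boldsymbol\mu_{m+k^*-1}\ne\boldsymbol\mu_{m+k^*}=\cdots=\boldsymbol\mu_{m+Tm}$$ holds, where $\boldsymbol\mu_t=(\mu_{t,1},\dots,\mu_{t,d})^\top$, and assume that there is a component $h^*$ such that, with the change time $k^*=k^*(m)$, $$\sqrt{\frac m{\log m}}\,\big|\mu_{m+k^*-1,h^*}-\mu_{m+k^*,h^*}\big|\to\infty\qquad\text{and}\qquad\limsup_{m\to\infty}\frac{k^*}{m}<T .$$ Let $$\widehat{\mathcal T}_{m,d}=\max_{k=1}^{Tm}\ \max_{h=1}^d\ \max_{j=0}^{k-1}\ \frac{1}{1+k/m}\,\frac{k-j}{\sqrt m\,\hat\sigma_h}\Big|\hat\mu_{m+j+1}^{m+k}(h)-\hat\mu_1^{m+j}(h)\Big| .$$ Then, for $\alpha\in(0,1)$ and $g_{1-\alpha}$ the $(1-\alpha)$-quantile of the standard Gumbel distribution (distribution function $x\mapsto\exp(-\exp(-x))$), $$\lim_{m,d\to\infty}\mathbb P\Big(\widehat{\mathcal T}_{m,d}>\frac{g_{1-\alpha}}{a_d}+b_d\Big)=1 .$$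
   Context: Setting. $T>0$ is a fixed constant with $Tm\in\mathbb N$; $m$ is the size of an initial sample, $d=d_m$ is the dimension, and limits $m,d\to\infty$ are taken as $m\to\infty$ with $d=d_m$ satisfying (D1) below. The observations are $X_{t,h}=\mu_{t,h}+e_{t,h}$, $t\in\mathbb Z$, $h\in\mathbb N$, with $\mu_{t,h}=\mathbb E[X_{t,h}]\in\mathbb R$ (the means may depend on $m$) and centered errors $e_{t,h}=g_h(\varepsilon_t,\varepsilon_{t-1},\dots)$, where $\{\varepsilon_t\}_{t\in\mathbb Z}$ are i.i.d. random variables with values in a measurable space $\mathbb S$ and $g_h:\mathbb S^{\mathbb N}\to\mathbb R$ are measurable. Only components $h=1,\dots,d$ and times $t=1,\dots,m+Tm$ are observed. Let $\varepsilon_0'$ be an independent copy of $\varepsilon_0$ (independent of all $\varepsilon_t$), $X'_{t,h}=\mu_{t,h}+g_h(\varepsilon_t,\dots,\varepsilon_1,\varepsilon_0',\varepsilon_{-1},\dots)$, and $\vartheta_{t,h,p}=\|X_{t,h}-X'_{t,h}\|_p$ with $\|X\|_p=\mathbb E[|X|^p]^{1/p}$ (assuming $\|e_{t,h}\|_p<\infty$). Define $\gamma_{h,i}=\sum_{t\in\mathbb Z}\operatorname{Cov}(X_{0,h},X_{t,i})$, $\sigma_h^2=\gamma_{h,h}$ with $\sigma_h\ge 0$, and the long-run correlations $\rho_{h,i}=\gamma_{h,i}/(\sigma_h\sigma_i)$. Assumptions: (D1) There are constants $D>0$, $C_D>0$ with $m^{1/C_D}\le d\le C_D m^D$. (S1)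 There are a positive sequence $B_m\le m^B$ with constant $B<3/8$ and a constant $C_e>1$ with $\max_{h=1}^d\mathbb E[\exp(|e_{1,h}|/B_m)]\le C_e$. (TD1) There are constants $p>2D+4$, $\beta\in[0,1)$, $C_\vartheta>0$ with $\sup_{h\in\mathbb N}\vartheta_{t,h,p}\le C_\vartheta\beta^t$ for all $t\in\mathbb N_0$. (TD2) There is a constant $c_\sigma>0$ with $c_\sigma\le\inf_{h\in\mathbb N}\sigma_h$. (SD1) There is a sequence $r_n\to0$ with $|\rho_{i,j}|\le(\log|i-j|)^{-2}r_{|i-j|}$ whenever $|i-j|\ge2$. (SD2) There is a constant $\rho_+\in[0,1)$ with $\sup_{|i-j|\ge1}|\rho_{i,j}|\le\rho_+$. (V) For each $h$, $\hat\sigma_h=\hat\sigma_h(m)$ is an estimator of $\sigma_h$ based only on the initial sample $\boldsymbol X_1,\dots,\boldsymbol X_m$ (where $\boldsymbol X_t=(X_{t,1},\dots,X_{t,d})^\top$) such that, for some positive constants $c'_\sigma,C'_\sigma,\delta_\sigma$, $\mathbb P(\max_{h=1}^d|\hat\sigma_h-\sigma_h|\ge m^{-\delta_\sigma})\le c'_\sigma m^{-C'_\sigma}$. Notation. $\hat\mu_i^j(h)=\frac1{j-i+1}\sum_{t=i}^jX_{t,h}$. With $q=T/(T+1)$, $$a_d=\sqrt{\frac{2\log d}{q}},\qquad b_d=\sqrt{2q\log d}-\frac{\sqrt q\,(\log\log d-\log\tfrac{16}{\pi})}{2\sqrt{2\log d}} .$$ *)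

(* Defs.v *)
From HB Require Import structures.
From mathcomp Require Import all_boot all_order all_algebra.
From mathcomp Require Import all_classical all_reals all_analysis.
Set Implicit Arguments.
Unset Strict Implicit.
Unset Printing Implicit Defensive.
Import Order.TTheory GRing.Theory Num.Theory.
Import numFieldNormedType.Exports.
Local Open Scope classical_set_scope.
Local Open Scope ring_scope.

(* Components [h] and monitoring times [k] are numbered from 1, as in the
   mathematical text; the value at index [h = 0] is never used. *)

Section Innovations.
Context {R : realType} {dO dS : measure_display}
  {Omega : measurableType dO} {S : measurableType dS}.
Variable P : probability Omega R.

Definition mutually_independent (I : choiceType) (Y : I -> Omega -> S) : Prop :=
  forall J : seq I, uniq J ->
  forall A : I -> set S, (forall i, measurable (A i)) ->
  P (\big[setI/setT]_(i <- J) (Y i @^-1` A i)) =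
  (\prod_(i <- J) P (Y i @^-1` A i))%E.

Definition identically_distributed (I : choiceType) (Y : I -> Omega -> S) : Prop :=
  forall (i j : I) (A : set S), measurable A -> P (Y i @^-1` A) = P (Y j @^-1` A).

Definition iid (I : choiceType) (Y : I -> Omega -> S) : Prop :=
  [/\ forall i, measurable_fun setT (Y i),
      mutually_independent Y & identically_distributed Y].

(* [None] indexes the independent copy of the innovation at time 0. *)
Definition with_copy (eps : int -> Omega -> S) (eps0' : Omega -> S)
    (o : option int) : Omega -> S :=
  if o is Some t then eps t else eps0'.

Definition past (eps : int -> Omega -> S) (t : int) (w : Omega) : nat -> S :=
  fun j => eps (t - j%:Z) w.

Definition past_copy (eps : int -> Omega -> S) (eps0' : Omega -> S)
    (t : int) (w : Omega) : nat -> S :=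
  fun j => if t - j%:Z == 0 then eps0' w else eps (t - j%:Z) w.

(* Measurability with respect to the countable product sigma-algebra, which is
   generated by the coordinate maps; [nat -> S] carries no such instance in the
   library. *)
Definition measurable_on_sequences (f : (nat -> S) -> R) : Prop :=
  forall B : set R, measurable B ->
  <<s \bigcup_n preimage_set_system setT (fun x : nat -> S => x n) measurable >>
    (f @^-1` B).

(* [e_{t,h}] and its coupled version *)
Definition err (g : nat -> (nat -> S) -> R) (eps : int -> Omega -> S)
    (t : int) (h : nat) (w : Omega) : R := g h (past eps t w).

Definition err_copy (g : nat -> (nat -> S) -> R) (eps : int -> Omega -> S)
    (eps0' : Omega -> S) (t : int) (h : nat) (w : Omega) : R :=
  g h (past_copy eps eps0' t w).

Definition location (mu : int -> nat -> R) (e : int -> nat -> Omega -> R)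
    (t : int) (h : nat) (w : Omega) : R := mu t h + e t h w.

(* [vartheta_{t,h,p}] *)
Definition vartheta (p : R) (X X' : int -> nat -> Omega -> R)
    (t : int) (h : nat) : \bar R :=
  'N[P]_(p%:E)[EFin \o (X t h \- X' t h)%R]%E.

(* Sum over all of Z, i.e. the sum of the positive parts minus the sum of the
   negative parts. *)
Definition sumZ (c : int -> \bar R) : \bar R :=
  (\esum_(t in setT) (c^\+ t) - \esum_(t in setT) (c^\- t))%E.

(* [gamma_{h,i}], [sigma_h], [rho_{h,i}] *)
Definition lr_cov (X : int -> nat -> Omega -> R) (h i : nat) : R :=
  fine (sumZ (fun t => covariance P (X 0 h) (X t i))).

Definition lr_sd (X : int -> nat -> Omega -> R) (h : nat) : R :=
  Num.sqrt (lr_cov X h h).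

Definition lr_corr (X : int -> nat -> Omega -> R) (h i : nat) : R :=
  lr_cov X h i / (lr_sd X h * lr_sd X i).

End Innovations.

Section Statistic.
Context {R : realType} {dO : measure_display} {Omega : measurableType dO}.

(* [\hat\mu_i^j(h)], for [i <= j] *)
Definition sample_mean (X : int -> nat -> Omega -> R) (i j h : nat)
    (w : Omega) : R :=
  (\sum_(i <= t < j.+1) X t%:Z h w) / (j.+1 - i)%:R.

(* The initial sample, as the vector of the [d]-dimensional vectors
   [X_1, ..., X_m]. *)
Definition initial_sample (X : int -> nat -> Omega -> R) (m d : nat)
    (w : Omega) : m.-tuple (d.-tuple R) :=
  [tuple [tuple X (t.+1)%:Z h.+1 w | h < d] | t < m].

(* Maxima are taken in the extended reals, with value [-oo] over the empty
   range. *)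
Definition max_stat (X : int -> nat -> Omega -> R) (shat : nat -> Omega -> R)
    (m d Tm : nat) (w : Omega) : \bar R :=
  \big[maxe/-oo%E]_(1 <= k < Tm.+1) \big[maxe/-oo%E]_(1 <= h < d.+1)
    \big[maxe/-oo%E]_(0 <= j < k)
      (1 / (1 + k%:R / m%:R) *
       ((k - j)%:R / (Num.sqrt m%:R * shat h w)) *
       `|sample_mean X (m + j + 1) (m + k) h w
         - sample_mean X 1 (m + j) h w|)%:E.

Definition max_sd_error (shat : nat -> Omega -> R) (s : nat -> R) (d : nat)
    (w : Omega) : \bar R :=
  \big[maxe/-oo%E]_(1 <= h < d.+1) `|shat h w - s h|%:E.

End Statistic.

Section Normalization.
Context {R : realType}.

Definition gumbel_cdf (x : R) : R := expR (- expR (- x)).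

Definition quantile (F : R -> R) (u : R) : R := inf [set x | u <= F x].

Definition qT (T : R) : R := T / (T + 1).

Definition norm_a (T : R) (d : nat) : R := Num.sqrt (2 * ln d%:R / qT T).

Definition norm_b (T : R) (d : nat) : R :=
  Num.sqrt (2 * qT T * ln d%:R) -
  Num.sqrt (qT T) * (ln (ln d%:R) - ln (16 / pi)) /
  (2 * Num.sqrt (2 * ln d%:R)).

(* Admissible sizes of the initial sample: the monitoring horizon [T m] has to
   be a natural number.  All asymptotics are along these [m]. *)
Definition sample_size (T : R) : set nat :=
  [set m | (0 < m)%N /\ T * m%:R \is a Num.nat].

Definition horizon (T : R) (m : nat) : nat := Num.truncn (T * m%:R).

Definition m_to_infty (T : R) : set_system nat := within (sample_size T) \oo.

(* The vector of means of the observed components at time [t] *)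
Definition mean_vec (mu : int -> nat -> R) (d t : nat) : 'rV[R]_d :=
  \row_(h < d) mu t%:Z h.+1.

(* A single change of the mean vector at monitoring time [k] *)
Definition mean_change (mu : int -> nat -> R) (m d Tm k : nat) : Prop :=
  [/\ (1 <= k <= Tm)%N,
      forall t, (1 <= t <= m + k - 1)%N -> mean_vec mu d t = mean_vec mu d 1,
      forall t, (m + k <= t <= m + Tm)%N ->
        mean_vec mu d t = mean_vec mu d (m + k)
    & mean_vec mu d (m + k - 1) != mean_vec mu d (m + k)].

End Normalization.

(* Main.v *)
(** The statistic is bounded below by the single term with [k = Tm],
    [h = hstar m], [j = kstar m - 1].  Its deterministic part is of order
    [sqrt m * |jump|], which dominates [sqrt (ln m)], while the threshold is
    [O(sqrt (ln m))] by (D1).  The noise consists of two partial sums of the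
    errors, so by Chebyshev's inequality it suffices that their variances grow
    at most linearly, uniformly in the component.

    This follows from geometrically decaying autocovariances, obtained without
    conditional expectations.  Let [A(s, u)] be the covariance of [g_h] applied
    to two innovation sequences that share everything from position [s] of the
    first, resp. [u] of the second, on, and are independent before.  Then
    [A(0, t)] is the lag [t] autocovariance.  Resampling the first shared
    innovation gives
    [2 |A(s, u) - A(s+1, u+1)| <= vartheta_s * vartheta_u], and
    [A(s, s+t) --> 0] as [s] grows because a function measurable for the product
    sigma-algebra is approximated in mean square by changing only its remote
    arguments.  All the couplings needed live on the given probability space:
    the law of a sequence of innovations depends only on which indices agree. *)

Require Import Defs.
From HB Require Import structures.
From mathcomp Require Import all_boot all_order all_algebra.
From mathcomp Require Import all_classical all_reals all_analysis.
From mathcomp Require Import measurable_realfun.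
From mathcomp Require Import zify ring lra.
Set Implicit Arguments.
Unset Strict Implicit.
Unset Printing Implicit Defensive.
Import Order.TTheory GRing.Theory Num.Theory.
Import numFieldNormedType.Exports.
Local Open Scope classical_set_scope.
Local Open Scope ring_scope.

(** * Laws of random sequences *)

Definition cylinder {d} {S : measurableType d} {J : choiceType} (s : seq J)
  (A : J -> set S) : set (J -> S) := [set x | forall j, j \in s -> A j (x j)].

(** A generating pi-system of the product sigma-algebra. The index type is arbitrary so that a pair
    of sequences can be treated as one family over a sum type. *)
Definition cylinders {d} {S : measurableType d} (J : choiceType) :
    set (set (J -> S)) :=
  [set B | exists s (A : J -> set S), (forall j, measurable (A j)) /\
    B = cylinder s A].

Lemma cylinder_setI_closed {d} {S : measurableType d} (J : choiceType) :
  setI_closed (@cylinders _ S J).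
Proof.
move=> _ _ [s1 [A1 [mA1 ->]]] [s2 [A2 [mA2 ->]]].
exists (s1 ++ s2), (fun j => (if j \in s1 then A1 j else setT) `&`
  (if j \in s2 then A2 j else setT)); split.
  by move=> j; apply: measurableI; case: ifP.
apply/seteqP; split => x.
  by move=> [h1 h2] j _; split; case: ifP => // ?; [exact: h1|exact: h2].
move=> h; split => j js; have := h j; rewrite mem_cat js ?orbT => /(_ isT) [].
  by [].
by [].
Qed.

Section pi_lambda.
Context {R : realType} {dO dS : measure_display}
  {Omega : measurableType dO} {S : measurableType dS}.
Variable P : probability Omega R.

Lemma preimage_sequence_measurable (J : choiceType) (x : Omega -> J -> S) :
  (forall j, measurable_fun setT (x ^~ j)) ->
  forall A, <<s @cylinders _ S J >> A -> measurable (x @^-1` A).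
Proof.
move=> mx; apply: smallest_sub.
  split => [|A mA|F mF].
  - by rewrite /= preimage_set0.
  - by rewrite /= setTD preimage_setC; exact: measurableC.
  - by rewrite /= preimage_bigcup; exact: bigcupT_measurable.
move=> _ [s [A [mA ->]]].
rewrite /= (_ : _ @^-1` _ = \big[setI/setT]_(j <- s) ((x ^~ j) @^-1` A j)).
  apply: bigsetI_measurable => j _.
  by rewrite -[X in measurable X]setTI; exact: mx.
rewrite -bigcap_seq; apply/seteqP; split => w h j; exact: h.
Qed.

(** Dynkin's pi-lambda argument: both sides are finite measures in [A]. The extra event [Y] lets one
    statement serve twice: [Y = setT] gives equality in law, and [x' = x] gives independence from
    [Y]. *)
Lemma sequence_law_eq (J : choiceType) (x x' : Omega -> J -> S) (Y : set Omega) :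
  (forall j, measurable_fun setT (x ^~ j)) ->
  (forall j, measurable_fun setT (x' ^~ j)) ->
  measurable Y ->
  (forall A, @cylinders _ S J A ->
     P (x @^-1` A `&` Y) = (P (x' @^-1` A) * P Y)%E) ->
  forall A, <<s @cylinders _ S J >> A ->
     P (x @^-1` A `&` Y) = (P (x' @^-1` A) * P Y)%E.
Proof.
move=> mx mx' mY cyl.
have mpx := preimage_sequence_measurable mx.
have mpx' := preimage_sequence_measurable mx'.
have PYfin : P Y \is a fin_num by exact: fin_num_measure.
apply: (@dynkin_induction _ (g_sigma_algebraType (@cylinders _ S J))) => //=.
- exact: cylinder_setI_closed.
- by rewrite !preimage_setT setTI probability_setT mul1e.
- move=> A mA h.
  have -> : x @^-1` (~` A) `&` Y = Y `\` (x @^-1` A).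
    by rewrite preimage_setC setDE setIC.
  have m1 := mpx A mA. have m2 := mpx' A mA.
  rewrite measureD //; last by rewrite ltey_eq PYfin.
  rewrite preimage_setC probability_setC //.
  transitivity (P Y - P (x @^-1` A `&` Y))%E; first by rewrite setIC.
  rewrite h.
  rewrite muleBl ?mul1e //.
- move=> F mF tF h.
  rewrite !preimage_bigcup setI_bigcupl.
  rewrite measure_bigcup //; last 2 first.
  + by move=> k _; apply: measurableI => //; exact: mpx (mF k).
  + apply/trivIsetP => i j _ _ ij.
    move/trivIsetP : tF => /(_ i j I I ij) e.
    by rewrite setIACA -preimage_setI e preimage_set0 set0I.
  rewrite measure_bigcup //; last 2 first.
  + by move=> k _; exact: mpx' (mF k).
  + apply/trivIsetP => i j _ _ ij.
    move/trivIsetP : tF => /(_ i j I I ij) e.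
    by rewrite -preimage_setI e preimage_set0.
  rewrite (eq_eseriesr (fun k _ => h k)).
  rewrite muleC -(fineK PYfin) -nneseriesZl; last by move=> *; exact: measure_ge0.
  by apply: eq_eseriesr => k _; rewrite muleC.
Qed.

End pi_lambda.

Section iid_sequences.
Context {R : realType} {dO dS : measure_display}
  {Omega : measurableType dO} {S : measurableType dS}.
Variable P : probability Omega R.
Context {K : choiceType} {Z : K -> Omega -> S}.
Hypothesis iidZ : iid P Z.

Definition subfamily (J : choiceType) (w : J -> K) : Omega -> J -> S :=
  fun o j => Z (w j) o.

Lemma subfamily_measurable (J : choiceType) (w : J -> K) j :
  measurable_fun setT ((@subfamily J w) ^~ j).
Proof. by case: iidZ => mZ _ _; exact: mZ. Qed.

(* A repeated index contributes the intersection of all its constraints. *)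
Definition constraint (J : choiceType) (w : J -> K) (s : seq J)
    (A : J -> set S) (k : K) : set S :=
  [set y | forall j, j \in s -> w j = k -> A j y].

Lemma constraint_measurable (J : choiceType) (w : J -> K) s (A : J -> set S) k :
  (forall j, measurable (A j)) -> measurable (constraint w s A k).
Proof.
move=> mA.
rewrite (_ : constraint _ _ _ _ =
    \big[setI/setT]_(j <- s | w j == k) A j); first exact: bigsetI_measurable.
rewrite -bigcap_seq_cond; apply/seteqP; split => y h j.
  by move=> /andP[js /eqP e]; exact: h.
by move=> js e; apply: h; rewrite /= js e eqxx.
Qed.

(** Grouping the coordinates by the innovation they read leaves pairwise distinct indices, the form
    in which mutual independence applies. *)
Lemma subfamily_cylinder (J : choiceType) (w : J -> K) s (A : J -> set S) :
  subfamily w @^-1` cylinder s A =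
  \big[setI/setT]_(k <- undup (map w s)) (Z k @^-1` constraint w s A k).
Proof.
rewrite -bigcap_seq; apply/seteqP; split => o h.
  by move=> k _ j js wj; have := h j js; rewrite /subfamily wj.
move=> j js; apply: (h (w j)) => //=.
by rewrite mem_undup map_f.
Qed.

Lemma subfamily_cylinder_prob (J : choiceType) (w : J -> K) s (A : J -> set S) :
  (forall j, measurable (A j)) ->
  P (subfamily w @^-1` cylinder s A) =
  (\prod_(k <- undup (map w s)) P (Z k @^-1` constraint w s A k))%E.
Proof.
move=> mA; rewrite subfamily_cylinder; case: iidZ => _ ind _.
by apply: ind; rewrite ?undup_uniq // => k; exact: constraint_measurable.
Qed.

(** Whether [undup] keeps an entry depends only on coincidences, so the same positions survive in
    both lists and the two products can be matched factor by factor. *)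
Lemma undup_map_pattern (J : choiceType) (w w' : J -> K) :
  (forall i j, (w i == w j) = (w' i == w' j)) ->
  forall s, exists s', undup (map w s) = map w s' /\
    undup (map w' s) = map w' s'.
Proof.
move=> ww'; elim => [|x s [s' [e e']]]; first by exists [::].
have mem : (w x \in map w s) = (w' x \in map w' s).
  apply/mapP/mapP => -[y ys /eqP].
    by rewrite ww' => /eqP ?; exists y.
  by rewrite -ww' => /eqP ?; exists y.
rewrite /= -mem; case: ifP => _; first by exists s'.
by exists (x :: s'); rewrite /= e e'.
Qed.

(** On cylinders, both probabilities are products over the same surviving positions. The constraint
    sets depend only on the coincidences, and the factors agree by identical distribution. *)
Lemma subfamily_law (J : choiceType) (w w' : J -> K) :
  (forall i j, (w i == w j) = (w' i == w' j)) ->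
  forall A, <<s @cylinders _ S J >> A ->
    P (subfamily w @^-1` A) = P (subfamily w' @^-1` A).
Proof.
move=> ww' A sA.
suff : P (subfamily w @^-1` A `&` setT) = (P (subfamily w' @^-1` A) * P setT)%E.
  by rewrite setIT probability_setT mule1.
apply: sequence_law_eq sA => //; try exact: subfamily_measurable.
move=> _ [s [B [mB ->]]].
rewrite setIT probability_setT mule1 !subfamily_cylinder_prob //.
have [s' [-> ->]] := undup_map_pattern ww' s.
rewrite !big_map; apply: eq_bigr => i _.
have -> : constraint w s B (w i) = constraint w' s B (w' i).
  apply/seteqP; split => y h j js /eqP.
    by rewrite -ww' => /eqP; exact: h.
  by rewrite ww' => /eqP; exact: h.
by case: iidZ => _ _; apply; exact: constraint_measurable.
Qed.

(** The pi-lambda argument is run twice, once in each event, which leaves two cylinders that read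
    disjoint sets of innovations. *)
Lemma subfamily_independent (J J' : choiceType) (w : J -> K) (w' : J' -> K) :
  (forall i j, w i != w' j) ->
  forall A B, <<s @cylinders _ S J >> A -> <<s @cylinders _ S J' >> B ->
    P (subfamily w @^-1` A `&` subfamily w' @^-1` B) =
    (P (subfamily w @^-1` A) * P (subfamily w' @^-1` B))%E.
Proof.
move=> ww' A B sA sB.
have mw := preimage_sequence_measurable (subfamily_measurable w).
have mw' := preimage_sequence_measurable (subfamily_measurable w').
apply: sequence_law_eq sA => //; try exact: subfamily_measurable.
  exact: mw'.
move=> A' cA; rewrite setIC muleC.
have sA' := @sub_sigma_algebra _ setT _ _ cA.
apply: sequence_law_eq sB => //; try exact: subfamily_measurable.
  exact: mw.
case: cA => s [C [mC ->]] _ [s' [C' [mC' ->]]].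
rewrite !subfamily_cylinder_prob // !subfamily_cylinder.
(* Since the two index sets are disjoint, one of the two constraints is vacuous at each index; [D]
   is thus a single family for the concatenated list. *)
pose D k := constraint w s C k `&` constraint w' s' C' k.
have D1 k : k \in undup (map w s) -> D k = constraint w s C k.
  rewrite mem_undup => /mapP[j js ->]; apply/seteqP; split => y; first by case.
  by move=> h; split => // j' _ /esym/eqP; rewrite (negPf (ww' _ _)).
have D2 k : k \in undup (map w' s') -> D k = constraint w' s' C' k.
  rewrite mem_undup => /mapP[j js ->]; apply/seteqP; split => y; first by case.
  by move=> h; split => // j' _ /eqP; rewrite (negPf (ww' _ _)).
pose u := undup (map w' s') ++ undup (map w s).
have uu : uniq u.
  rewrite cat_uniq !undup_uniq /= andbT; apply/hasPn => k.
  rewrite mem_undup => /mapP[j _ ->]; rewrite mem_undup; apply/mapP => -[j' _].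
  by move/eqP; rewrite (negPf (ww' _ _)).
have mD k : measurable (D k).
  by apply: measurableI; exact: constraint_measurable.
case: iidZ => _ ind _.
have := ind u uu D mD; rewrite /u !big_cat /=.
have e1 : \big[setI/setT]_(k <- undup (map w s)) (Z k @^-1` D k) =
  \big[setI/setT]_(k <- undup (map w s)) (Z k @^-1` constraint w s C k).
  by apply: eq_big_seq => k /D1 ->.
have e2 : \big[setI/setT]_(k <- undup (map w' s')) (Z k @^-1` D k) =
  \big[setI/setT]_(k <- undup (map w' s')) (Z k @^-1` constraint w' s' C' k).
  by apply: eq_big_seq => k /D2 ->.
rewrite e1 e2 => ->; congr (_ * _)%E.
  by apply: eq_big_seq => k /D2 ->.
by apply: eq_big_seq => k /D1 ->.
Qed.

End iid_sequences.

(** * Functionals of sequences of innovations *)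

Section sequence_functionals.
Context {R : realType} {dO dS : measure_display}
  {Omega : measurableType dO} {S : measurableType dS}.
Variable P : probability Omega R.

(** Coordinate [n] of [x \o a] is coordinate [a n] of [x], so generating sets pull back to
    one-coordinate cylinders. It is used with the identity and with the two injections into
    [nat + nat]. *)
Lemma measurable_on_sequences_reindex (J : choiceType) (f : (nat -> S) -> R)
    (a : nat -> J) : measurable_on_sequences f ->
  measurable_fun [set: g_sigma_algebraType (@cylinders _ S J)]
    (fun x => f (x \o a)).
Proof.
move=> mf _ B mB; rewrite setTI.
have : <<s \bigcup_n preimage_set_system setT (fun x : nat -> S => x n)
  measurable >> `<=`
  [set A | <<s @cylinders _ S J >> ((fun x : J -> S => x \o a) @^-1` A)].
  apply: smallest_sub.
    split => [|A mA|F mF].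
    - by rewrite /= preimage_set0; exact: sigma_algebra0.
    - by rewrite /= setTD preimage_setC; exact: sigma_algebraC.
    - by rewrite /= preimage_bigcup; exact: sigma_algebra_bigcup.
  move=> _ [n _ [C mC <-]] /=.
  apply: sub_sigma_algebra; exists [:: a n], (fun=> C); split => //.
  apply/seteqP; split => x /=.
    by move=> [_ Cx] j; rewrite inE => /eqP ->.
  by move=> h; split => //; apply: (h (a n)); rewrite inE.
by move=> /(_ _ (mf _ mB)).
Qed.

Context {K : choiceType} {Z : K -> Omega -> S}.
Hypothesis iidZ : iid P Z.

Notation on w := (fun o i => Z (w i) o).

Lemma functional_measurable (f : (nat -> S) -> R) (a : nat -> K) :
  measurable_on_sequences f -> measurable_fun setT (fun o => f (on a o)).
Proof.
move=> mf _ B mB; rewrite setTI.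
have := measurable_on_sequences_reindex (@id nat) mf measurableT mB.
rewrite setTI => h.
by have := preimage_sequence_measurable (subfamily_measurable iidZ a) h.
Qed.

Definition same_pattern (a b a' b' : nat -> K) : Prop :=
  forall i j, [/\ (a i == a j) = (a' i == a' j), (b i == b j) = (b' i == b' j)
    & (a i == b j) = (a' i == b' j)].

Variables f1 f2 : (nat -> S) -> R.
Hypotheses (mf1 : measurable_on_sequences f1) (mf2 : measurable_on_sequences f2).

Lemma functional_pair_measurable (a b : nat -> K) :
  measurable_fun setT (fun o => (f1 (on a o), f2 (on b o))).
Proof. by apply: measurable_fun_pair; exact: functional_measurable. Qed.

(** Two sequences of innovations form one family over [nat + nat], whose coincidences are exactly
    those recorded by [same_pattern]. *)
Lemma functional_pair_law (a b a' b' : nat -> K) (B : set (R * R)) :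
  same_pattern a b a' b' -> measurable B ->
  P ((fun o => (f1 (on a o), f2 (on b o))) @^-1` B) =
  P ((fun o => (f1 (on a' o), f2 (on b' o))) @^-1` B).
Proof.
move=> pat mB.
pose w (a b : nat -> K) (j : nat + nat) :=
  match j with inl i => a i | inr i => b i end.
have ww' i j : (w a b i == w a b j) = (w a' b' i == w a' b' j).
  case: i j => i [] j /=; have [h1 h2 h3] := pat i j => //.
  by have [_ _ h] := pat j i; rewrite eq_sym h eq_sym.
pose F (x : g_sigma_algebraType (@cylinders _ S (nat + nat)%type)) :=
  (f1 (x \o inl), f2 (x \o inr)).
have mF : measurable_fun setT F.
  by apply: measurable_fun_pair; exact: measurable_on_sequences_reindex.
have := mF measurableT B mB; rewrite setTI => sB.
exact: (subfamily_law iidZ ww' sB).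
Qed.

(** Pushing forward to [R * R] settles nonnegative integrands. Treating positive and negative parts
    separately then avoids any integrability assumption, so the lemma can itself transfer
    integrability. *)
Lemma functional_pair_integral (a b a' b' : nat -> K) (h : R * R -> R) :
  same_pattern a b a' b' -> measurable_fun setT h ->
  (\int[P]_o (h (f1 (on a o), f2 (on b o)))%:E =
   \int[P]_o (h (f1 (on a' o), f2 (on b' o)))%:E)%E.
Proof.
move=> pat mh.
have mH : measurable_fun setT (fun x : R * R => (h x)%:E) by exact/measurable_EFinP.
have ge0 (k : R * R -> \bar R) : measurable_fun setT k ->
    (forall x, 0 <= k x)%E ->
    (\int[P]_o (k (f1 (on a o), f2 (on b o))) =
     \int[P]_o (k (f1 (on a' o), f2 (on b' o))))%E.
  move=> mk k0.
  have := @ge0_integral_pushforward _ _ _ _ _ _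
    (functional_pair_measurable a b) P setT k measurableT mk (fun x _ => k0 x).
  have := @ge0_integral_pushforward _ _ _ _ _ _
    (functional_pair_measurable a' b') P setT k measurableT mk (fun x _ => k0 x).
  rewrite !preimage_setT => <- <-.
  apply: eq_measure_integral; [exact: (functional_pair_measurable a' b')|
    exact: (functional_pair_measurable a b)|].
  by move=> ? ? B mB _; exact: functional_pair_law pat mB.
rewrite integralE [in RHS]integralE; congr (_ - _)%E.
  under eq_integral do rewrite funeposE.
  under [RHS]eq_integral do rewrite funeposE.
  apply: (ge0 (fun x => maxe (h x)%:E 0)%E) => [|x].
    exact: measurable_maxe.
  by rewrite le_max lexx orbT.
under eq_integral do rewrite funenegE.
under [RHS]eq_integral do rewrite funenegE.
apply: (ge0 (fun x => maxe (- (h x)%:E) 0)%E) => [|x].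
  by apply: measurable_maxe => //; exact: measurableT_comp.
by rewrite le_max lexx orbT.
Qed.

Lemma functional_pair_Rintegral (a b a' b' : nat -> K) (h : R * R -> R) :
  same_pattern a b a' b' -> measurable_fun setT h ->
  \int[P]_o h (f1 (on a o), f2 (on b o)) =
  \int[P]_o h (f1 (on a' o), f2 (on b' o)).
Proof. by move=> pat mh; congr fine; exact: functional_pair_integral. Qed.

Lemma functional_pair_integrable (a b a' b' : nat -> K) (h : R * R -> R) :
  same_pattern a b a' b' -> measurable_fun setT h ->
  P.-integrable setT (fun o => (h (f1 (on a o), f2 (on b o)))%:E) ->
  P.-integrable setT (fun o => (h (f1 (on a' o), f2 (on b' o)))%:E).
Proof.
move=> pat mh /integrableP[_ fin]; apply/integrableP; split.
  apply/measurable_EFinP.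
  by apply: (measurableT_comp mh); exact: functional_pair_measurable.
move: fin; rewrite (@functional_pair_integral a b a' b' (fun x => `|h x|)) //.
exact: measurableT_comp.
Qed.

(** Disjoint indices make the joint law a product measure; by Fubini, the inner integral over the
    second factor is a multiple of its mean, which is zero. *)
Lemma functional_independent_prod (a b : nat -> K) :
  (forall i j, a i != b j) ->
  P.-integrable setT (fun o => (f1 (on a o) * f2 (on b o))%:E) ->
  P.-integrable setT (fun o => (f2 (on b o))%:E) ->
  \int[P]_o f2 (on b o) = 0 ->
  \int[P]_o (f1 (on a o) * f2 (on b o)) = 0.
Proof.
move=> dis i12 i2 E0.
pose U1 : {RV P >-> R} := mfun_Sub (mem_set (functional_measurable a mf1)).
pose U2 : {RV P >-> R} := mfun_Sub (mem_set (functional_measurable b mf2)).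
pose U12 : {RV P >-> (R * R)%type} := mfun_Sub (mem_set (functional_pair_measurable a b)).
have law B : measurable B ->
    (distribution P U1 \x distribution P U2)%E B = distribution P U12 B.
  apply: product_measure_unique => A C mA mC.
  have sA := measurable_on_sequences_reindex (@id nat) mf1 measurableT mA.
  have sC := measurable_on_sequences_reindex (@id nat) mf2 measurableT mC.
  rewrite !setTI in sA sC.
  exact: (subfamily_independent iidZ dis sA sC).
pose h (x : R * R) := (x.1 * x.2)%:E.
have mh : measurable_fun setT h.
  by apply/measurable_EFinP; exact: measurable_funM.
rewrite /Rintegral.
have -> : (\int[P]_o (f1 (on a o) * f2 (on b o))%:E =
    \int[distribution P U12]_x h x)%E.
  by rewrite integral_distribution.
have -> : (\int[distribution P U12]_x h x =
   \int[distribution P U1 \x distribution P U2]_x h x)%E.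
  by apply: eq_measure_integral => B mB _; apply: esym; exact: law.
rewrite -integral12_prod_meas1 /=; last first.
  apply/integrableP; split => //.
  rewrite (_ : \int[_]_x _ = \int[distribution P U12]_x `|h x|)%E; last first.
    by apply: eq_measure_integral => B mB _; exact: law.
  rewrite ge0_integral_distribution //; last exact: measurableT_comp.
  by case/integrableP : i12.
rewrite (_ : \int[_]_x _ = \int[distribution P U1]_x 0)%E; last first.
  apply: eq_integral => x _; rewrite /fubini_F /h /=.
  under eq_integral do rewrite EFinM.
  rewrite integralZl //; last first.
    exact: integrable_pushforward.
  rewrite integral_distribution //.
  move: E0; rewrite /Rintegral.
  have fin : (\int[P]_o (f2 (on b o))%:E)%E \is a fin_num.
    by apply: integrable_fin_num.
  by move=> E0; rewrite (_ : \int[_]_x _ = 0)%E ?mule0 // -(fineK fin) E0.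
by rewrite integral0.
Qed.

End sequence_functionals.

(** * Approximation by finitely many coordinates *)

Section finite_coordinate_approximation.
Context {R : realType} {dO dS : measure_display}
  {Omega : measurableType dO} {S : measurableType dS}.
Variable P : probability Omega R.
Context {K : choiceType} {Z : K -> Omega -> S}.
Hypothesis iidZ : iid P Z.
Variables (a : nat -> nat -> K) (b : nat -> K).
Hypotheses (inja : forall s, injective (a s)) (injb : injective b).
Hypothesis ab : forall s i, (i < s)%N -> a s i = b i.

Let X := subfamily (Z := Z) b.
Let Xs s := subfamily (Z := Z) (a s).
Let seqsigma := <<s @cylinders _ S nat >>.

Definition disagree s (A : set (nat -> S)) : set Omega :=
  (X @^-1` A `\` Xs s @^-1` A) `|` (Xs s @^-1` A `\` X @^-1` A).

Definition eventually_agree (A : set (nat -> S)) : Prop :=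
  forall e : R, 0 < e -> exists N, forall s, (N <= s)%N ->
    (P (disagree s A) <= e%:E)%E.

Lemma disagree_measurable s A : seqsigma A -> measurable (disagree s A).
Proof.
move=> sA; have m1 := preimage_sequence_measurable (subfamily_measurable iidZ b) sA.
have m2 := preimage_sequence_measurable (subfamily_measurable iidZ (a s)) sA.
by apply: measurableU; exact: measurableD.
Qed.

Lemma eventually_agree_finite (A : nat -> set (nat -> S)) M :
  (forall i, seqsigma (A i)) -> (forall i, eventually_agree (A i)) ->
  forall e : R, 0 < e -> exists N, forall s, (N <= s)%N ->
    (P (\big[setU/set0]_(i < M) disagree s (A i)) <= e%:E)%E.
Proof.
move=> sA ag; elim: M => [|M IH] e e0.
  by exists 0%N => s _; rewrite big_ord0 measure0 lee_fin ltW.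
have e2 : 0 < e / 2 by rewrite divr_gt0.
have [N1 h1] := IH _ e2; have [N2 h2] := ag M _ e2.
exists (maxn N1 N2) => s; rewrite geq_max => /andP[s1 s2].
rewrite big_ord_recr /= (le_trans (measureU2 _ _ _)) //.
- by apply: bigsetU_measurable => i _; exact: disagree_measurable.
- exact: disagree_measurable.
- by rewrite [e in leRHS]splitr EFinD leeD // ?h1 ?h2.
Qed.

(** The tails decrease to the empty set, so continuity of [P] from above applies. *)
Lemma tail_union_small (F : nat -> set (nat -> S)) (e : R) :
  (forall i, seqsigma (F i)) -> 0 < e ->
  exists M, (P (X @^-1` (\bigcup_i F i `\` \big[setU/set0]_(i < M) F i)) <= e%:E)%E.
Proof.
move=> sF e0.
have mX := preimage_sequence_measurable (subfamily_measurable iidZ b).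
pose T M := X @^-1` (\bigcup_i F i `\` \big[setU/set0]_(i < M) F i).
have mT M : measurable (T M).
  rewrite /T -(bigcup_mkord M F) setDE preimage_setI preimage_setC.
  rewrite -setDE !preimage_bigcup.
  apply: measurableD; first by apply: bigcupT_measurable => i; exact: mX (sF i).
  by apply: bigcup_measurable => i _; exact: mX (sF i).
have T0 : \bigcap_M T M = set0.
  apply/seteqP; split => // o h; have [[i _ Fi] _] := h 0%N I.
  have [_] := h i.+1 I; apply; rewrite -(bigcup_mkord _ F).
  by exists i => //=.
have : P (T M) @[M --> \oo] --> P (\bigcap_M T M).
  apply: nonincreasing_cvg_mu => //.
  - by rewrite (le_lt_trans (probability_le1 P (mT 0%N))) // ltry.
  - exact: bigcapT_measurable.
  - move=> m n mn; apply/subsetPset => o [h1 h2]; split => // h3; apply: h2.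
    move: h3; rewrite -!(bigcup_mkord _ F) => -[i /= im Fi]; exists i => //=.
    exact: leq_trans im mn.
rewrite T0 measure0 => /fine_cvgP[_ /cvgrPdist_le /(_ e e0) [M _ /(_ M (leqnn _)) /=]].
rewrite sub0r normrN => h; exists M.
rewrite -/(T M) -(fineK (fin_num_measure P _ (mT M))) lee_fin.
exact: le_trans (ler_norm _) h.
Qed.

(** Good sets principle: the sets with vanishing disagreement form a sigma-algebra containing the
    cylinders. For a countable union, finitely many members are handled directly and the rest
    through a tail of small probability. *)
Lemma eventually_agree_sigma A : seqsigma A -> eventually_agree A.
Proof.
suff : seqsigma `<=` [set A | seqsigma A /\ eventually_agree A].
  by move=> h /h[].
apply: smallest_sub.
  split => [|B [sB aB]|F hF].
  - split; first exact: sigma_algebra0.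
    move=> e e0; exists 0%N => s _.
    rewrite /disagree !preimage_set0 !set0D setU0 measure0.
    by rewrite lee_fin ltW.
  - rewrite setTD; split; first exact: sigma_algebraC.
    move=> e e0; have [N h] := aB e e0; exists N => s /h.
    rewrite (_ : disagree s (~` B) = disagree s B) //.
    apply/seteqP; split => o [] [h1 h2].
    + by right; split => //; exact: contrapT.
    + by left; split => //; exact: contrapT.
    + by right; split => // h; exact: h.
    + by left; split => // h; exact: h.
  - have sF i : seqsigma (F i) by case: (hF i).
    have aF i : eventually_agree (F i) by case: (hF i).
    split; first exact: sigma_algebra_bigcup.
    move=> e e0; have e4 : 0 < e / 4 by rewrite divr_gt0.
    have e2 : 0 < e / 2 by rewrite divr_gt0.
    have [M hM] := tail_union_small sF e4.
    have [N hN] := eventually_agree_finite M sF aF e2.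
    exists N => s Ns; set T := _ `\` _ in hM.
    have sT : seqsigma T.
      rewrite /T setDE -[_ `&` _]setCK setCI setCK.
      apply: sigma_algebraC; rewrite -bigcup2E.
      apply: sigma_algebra_bigcup => -[|[|k]] /=.
      + by apply: sigma_algebraC; exact: sigma_algebra_bigcup.
      + rewrite -(bigcup_mkord _ F) bigcup_mkcond; apply: sigma_algebra_bigcup => i.
        by case: ifP => _; [exact: sF|exact: sigma_algebra0].
      + exact: sigma_algebra0.
    (* Both index maps are injective, so the two sequences have the same law and the tail is equally
       small for both, uniformly in [s]. *)
    have PT : P (Xs s @^-1` T) = P (X @^-1` T).
      apply: (subfamily_law iidZ) => // i j.
      by rewrite (inj_eq (@inja s)) (inj_eq injb).
    have PT' : (P (Xs s @^-1` T) <= (e / 4)%:E)%E by rewrite PT.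
    have mT1 := preimage_sequence_measurable (subfamily_measurable iidZ b) sT.
    have mT2 := preimage_sequence_measurable (subfamily_measurable iidZ (a s)) sT.
    have mU : measurable (\big[setU/set0]_(i < M) disagree s (F i)).
      by apply: bigsetU_measurable => i _; exact: disagree_measurable.
    (* If no [F i] with [i < M] distinguishes the sequences, the one lying in the union can only
       have entered it through the tail [T]. *)
    have sub : disagree s (\bigcup_i F i) `<=`
        \big[setU/set0]_(i < M) disagree s (F i) `|` (X @^-1` T `|` Xs s @^-1` T).
      move=> o; rewrite -(bigcup_mkord M (fun i => disagree s (F i))).
      rewrite /T -(bigcup_mkord M F) /disagree /= => h.
      have [[i im]|no] := pselect (exists2 i, (i < M)%N & disagree s (F i) o).
        by left; exists i.
      right; case: h => -[[i _ Fi] nF]; [left|right];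
        (split; first by exists i) => -[j /= jM Fj];
        apply: no; exists j => //.
        by left; split => // h; apply: nF; exists j.
      by right; split => // h; apply: nF; exists j.
    apply: (@le_trans _ _ (P (\big[setU/set0]_(i < M) disagree s (F i) `|`
        (X @^-1` T `|` Xs s @^-1` T)))).
      apply: le_measure => //; rewrite inE.
        by apply: disagree_measurable; exact: sigma_algebra_bigcup.
      by apply: measurableU => //; exact: measurableU.
    apply: (le_trans (measureU2 _ _ _)) => //; try exact: measurableU.
    apply: (@le_trans _ _ ((e / 2)%:E + ((e / 4)%:E + (e / 4)%:E))%E).
      apply: leeD; first exact: hN.
      by apply: (le_trans (measureU2 _ _ _)) => //; apply: leeD; [exact: hM|exact: PT'].
    by rewrite -!EFinD lee_fin; lra.
move=> _ [u [C [mC ->]]].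
have cC : seqsigma (cylinder u C) by apply: sub_sigma_algebra; exists u, C.
(* Beyond the largest constrained coordinate, the two sequences coincide wherever the cylinder
   looks. *)
split => // e e0; exists (\max_(j <- u) j).+1 => s Ns.
have e' o j : j \in u -> X o j = Xs s o j.
  move=> ju; rewrite /X /Xs /subfamily ab //.
  by apply: leq_trans Ns; rewrite ltnS; exact: leq_bigmax_seq.
rewrite (_ : disagree _ _ = set0) ?measure0 ?lee_fin ?ltW //.
apply/seteqP; split => // o [] [h]; apply => j ju /=.
  by rewrite -e' //; exact: h.
by rewrite e' //; exact: h.
Qed.

End finite_coordinate_approximation.

(** * Expectations of real random variables *)

Section real_expectation.
Context {R : realType} {d : measure_display} {Omega : measurableType d}.
Variable P : probability Omega R.

Definition rv_integrable (f : Omega -> R) :=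
  P.-integrable setT (fun o => (f o)%:E).

Lemma rv_integrableD f g : rv_integrable f -> rv_integrable g ->
  rv_integrable (fun o => f o + g o).
Proof. by move=> hf hg; have := integrableD measurableT hf hg. Qed.

Lemma rv_integrableZ c f : rv_integrable f -> rv_integrable (fun o => c * f o).
Proof. by move=> hf; have := integrableZl measurableT c hf. Qed.

Lemma rv_integrableB f g : rv_integrable f -> rv_integrable g ->
  rv_integrable (fun o => f o - g o).
Proof. by move=> hf hg; have := integrableB measurableT hf hg. Qed.

Lemma rv_integrable_cst c : rv_integrable (fun=> c).
Proof. exact: finite_measure_integrable_cst. Qed.

Lemma rv_integrable_le (f g : Omega -> R) : measurable_fun setT f ->
  (forall o, `|f o| <= g o) -> rv_integrable g -> rv_integrable f.
Proof.
move=> mf fg; apply: le_integrable => //; first exact/measurable_EFinP.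
by move=> o _ /=; rewrite lee_fin (le_trans (fg o)) // ler_norm.
Qed.

Lemma rv_integrable_indic (A : set Omega) : measurable A -> rv_integrable (\1_A).
Proof.
move=> mA; apply: (rv_integrable_le _ _ (rv_integrable_cst 1)).
  exact: measurable_indic.
by move=> o; rewrite indicE; case: (_ \in _) => /=; rewrite ?normr1 ?normr0.
Qed.

Lemma rv_expectD f g : rv_integrable f -> rv_integrable g ->
  \int[P]_o (f o + g o) = \int[P]_o f o + \int[P]_o g o.
Proof. by move=> hf hg; rewrite RintegralD. Qed.

Lemma rv_expectB f g : rv_integrable f -> rv_integrable g ->
  \int[P]_o (f o - g o) = \int[P]_o f o - \int[P]_o g o.
Proof. by move=> hf hg; rewrite RintegralB. Qed.

Lemma rv_expectZ c f : rv_integrable f ->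
  \int[P]_o (c * f o) = c * \int[P]_o f o.
Proof. by move=> hf; rewrite RintegralZl. Qed.

Lemma rv_expect_cst c : \int[P]_o c = c.
Proof. by rewrite Rintegral_cst //= [X in fine X]probability_setT mulr1. Qed.

Lemma rv_expect_le f g : rv_integrable f -> rv_integrable g ->
  (forall o, f o <= g o) -> \int[P]_o f o <= \int[P]_o g o.
Proof. by move=> hf hg fg; apply: le_Rintegral. Qed.

Lemma rv_expect_indic (A : set Omega) : measurable A ->
  \int[P]_o (\1_A o) = fine (P A).
Proof. by move=> mA; rewrite /Rintegral integral_indic // setIT. Qed.

Lemma rv_square_integrable_fourth (f : Omega -> R) : measurable_fun setT f ->
  rv_integrable (fun o => f o ^+ 4) -> rv_integrable (fun o => f o ^+ 2).
Proof.
move=> mf h; apply: (@rv_integrable_le _ (fun o => 1 + f o ^+ 4)).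
- exact: measurable_funX.
- move=> o; rewrite ger0_norm ?sqr_ge0 //.
  have : 0 <= (f o ^+ 2 - 1) ^+ 2 by exact: sqr_ge0.
  have : 0 <= f o ^+ 2 by exact: sqr_ge0.
  by nra.
- by apply: rv_integrableD => //; exact: rv_integrable_cst.
Qed.

Lemma rv_integrable_prod (f g : Omega -> R) :
  measurable_fun setT f -> measurable_fun setT g ->
  rv_integrable (fun o => f o ^+ 2) -> rv_integrable (fun o => g o ^+ 2) ->
  rv_integrable (fun o => f o * g o).
Proof.
move=> mf mg hf hg; apply: (rv_integrable_le _ _ (rv_integrableD hf hg)).
  exact: measurable_funM.
by move=> o; rewrite ler_norml; apply/andP; split; nra.
Qed.

(** The weight [c] stays free so that factors with very different mean squares can be balanced. *)
Lemma rv_young (f g : Omega -> R) c : 0 < c ->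
  measurable_fun setT f -> measurable_fun setT g ->
  rv_integrable (fun o => f o ^+ 2) -> rv_integrable (fun o => g o ^+ 2) ->
  `|\int[P]_o (f o * g o)| <=
    (c * \int[P]_o (f o ^+ 2) + c^-1 * \int[P]_o (g o ^+ 2)) / 2.
Proof.
move=> c0 mf mg hf hg.
have ifg := rv_integrable_prod mf mg hf hg.
have i1 := rv_integrableZ (c / 2) hf; have i2 := rv_integrableZ (c^-1 / 2) hg.
(* Here [s] is a sign; its two values give the two halves of the bound on the absolute value. *)
have ub (s x y : R) : s ^+ 2 = 1 ->
    s * (x * y) <= c / 2 * x ^+ 2 + c^-1 / 2 * y ^+ 2.
  move=> s1; have : 0 <= (c * x - s * y) ^+ 2 / (2 * c).
    by rewrite divr_ge0 ?sqr_ge0 // mulr_ge0 // ltW.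
  have -> : (c * x - s * y) ^+ 2 / (2 * c) =
      c / 2 * x ^+ 2 + s ^+ 2 * (c^-1 / 2 * y ^+ 2) - s * (x * y).
    by field; rewrite gt_eqF.
  by rewrite s1 mul1r subr_ge0.
have -> : (c * \int[P]_o (f o ^+ 2) + c^-1 * \int[P]_o (g o ^+ 2)) / 2 =
    \int[P]_o (c / 2 * f o ^+ 2 + c^-1 / 2 * g o ^+ 2).
  by rewrite rv_expectD // !rv_expectZ //; ring.
rewrite ler_norml; apply/andP; split.
  rewrite lerNl -mulN1r -rv_expectZ //; apply: rv_expect_le.
  - exact: rv_integrableZ.
  - exact: rv_integrableD.
  - by move=> o; apply: ub; rewrite sqrrN expr1n.
apply: rv_expect_le => //; first exact: rv_integrableD.
by move=> o; rewrite -[X in X <= _]mul1r; apply: ub; rewrite expr1n.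
Qed.

End real_expectation.

(** * Mean square approximation by changing remote arguments *)

Section mean_square_approximation.
Context {R : realType} {dO dS : measure_display}
  {Omega : measurableType dO} {S : measurableType dS}.
Variable P : probability Omega R.
Context {K : choiceType} {Z : K -> Omega -> S}.
Hypothesis iidZ : iid P Z.

Notation on w := (fun o i => Z (w i) o).

(** The four terms cover four cases: the values are close; [U] is large; the exceptional event [H]
    occurs; or the squared error exceeds [C], in which case it is at most its own square divided by
    [C]. *)
Lemma quadratic_truncation (U V del C : R) (n : nat) (H : bool) :
  0 < del -> 0 < C -> (0 < n)%N ->
  (`|U| < n%:R * del -> ~~ H -> `|V - U| <= del) ->
  (V - U) ^+ 2 <= del ^+ 2 + C * (U ^+ 2 / (n%:R * del) ^+ 2)
    + C * H%:R + 8 / C * (U ^+ 4 + V ^+ 4).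
Proof.
move=> d0 C0 n0 h; have nd0 : 0 < n%:R * del by rewrite mulr_gt0 // ltr0n.
have p1 : 0 <= C * (U ^+ 2 / (n%:R * del) ^+ 2).
  by rewrite mulr_ge0 ?(ltW C0) // divr_ge0 ?sqr_ge0.
have p2 : 0 <= C * H%:R by rewrite mulr_ge0 ?(ltW C0).
have p3 : 0 <= del ^+ 2 by exact: sqr_ge0.
(* Convexity of the fourth power; the squares listed below are certificates for [nra]. *)
have q4 : (V - U) ^+ 4 <= 8 * (U ^+ 4 + V ^+ 4).
  have := sqr_ge0 (U + V); have := sqr_ge0 (U - V).
  have := sqr_ge0 (U ^+ 2 - V ^+ 2); have := sqr_ge0 ((U + V) ^+ 2).
  have := mulr_ge0 (sqr_ge0 (U + V)) (sqr_ge0 (U - V)).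
  have := sqr_ge0 (U * V).
  rewrite (_ : (V - U) ^+ 4 = ((V - U) ^+ 2) ^+ 2); last by rewrite -exprM.
  rewrite (_ : U ^+ 4 = (U ^+ 2) ^+ 2); last by rewrite -exprM.
  rewrite (_ : V ^+ 4 = (V ^+ 2) ^+ 2); last by rewrite -exprM.
  by nra.
have p4 : (V - U) ^+ 4 / C <= 8 / C * (U ^+ 4 + V ^+ 4).
  rewrite ler_pdivrMr // (_ : _ * C = 8 * (U ^+ 4 + V ^+ 4)) //.
  by field; rewrite gt_eqF.
have p5 : 0 <= 8 / C * (U ^+ 4 + V ^+ 4).
  apply: le_trans p4; rewrite divr_ge0 ?(ltW C0) //.
  by rewrite (_ : 4%N = (2 * 2)%N) // exprM sqr_ge0.
have [small|large] := leP `|V - U| del.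
  have : (V - U) ^+ 2 <= del ^+ 2.
    rewrite -[(V - U) ^+ 2]real_normK ?num_real //.
    by rewrite ler_sqr ?nnegrE // ltW.
  by lra.
have big : C <= C * (U ^+ 2 / (n%:R * del) ^+ 2) + C * H%:R.
  rewrite -mulrDr -[X in X <= _]mulr1 ler_pM2l //.
  have [u|u] := ltP `|U| (n%:R * del).
    case: (boolP H) => [_|nH]; last by move: (h u nH); rewrite leNgt large.
    by rewrite lerDr divr_ge0 ?sqr_ge0.
  rewrite -[X in X <= _]addr0 lerD // ler_pdivlMr ?exprn_gt0 // mul1r.
  by rewrite -[U ^+ 2]real_normK ?num_real // ler_sqr ?nnegrE // ltW.
have [DC|DC] := leP ((V - U) ^+ 2) C; first by lra.
have : (V - U) ^+ 2 <= (V - U) ^+ 4 / C.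
  rewrite ler_pdivlMr // (_ : 4%N = (2 + 2)%N) // exprD ler_wpM2l ?sqr_ge0 //.
  exact: ltW.
by lra.
Qed.

Variables (a : nat -> nat -> K) (b : nat -> K).
Hypotheses (inja : forall s, injective (a s)) (injb : injective b).
Hypothesis ab : forall s i, (i < s)%N -> a s i = b i.
Variable f : (nat -> S) -> R.
Hypothesis mf : measurable_on_sequences f.
Hypothesis i4 : rv_integrable P (fun o => f (on b o) ^+ 4).

Let U o := f (on b o).
Let V s o := f (on (a s) o).

(** For [i < n + n] these level sets of width [del] tile the values from [- n * del] up to
    [n * del]; the shift by [n] lets natural numbers index them. *)
Let cell (del : R) (n : nat) (i : nat) : set (nat -> S) :=
  f @^-1` [set x | (i%:R - n%:R) * del <= x < (i%:R - n%:R + 1) * del].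

(** [U] lies in the cell numbered by the truncation of [U / del + n]; without disagreement [V] lies
    in the same cell. *)
Lemma same_cell_close del n s o : 0 < del -> `|U o| < n%:R * del ->
  ~ (\big[setU/set0]_(i < n + n) disagree (Z := Z) a b s (cell del n i)) o ->
  `|V s o - U o| <= del.
Proof.
move=> d0 Un nH; pose y := U o / del + n%:R.
have [lo hi] : - n%:R < U o / del /\ U o / del < n%:R.
  move: Un; rewrite ltr_norml => /andP[h1 h2]; split.
    by rewrite ltr_pdivlMr // mulNr.
  by rewrite ltr_pdivrMr.
have y0 : 0 <= y by rewrite /y; lra.
have /andP[t1 t2] := truncn_itv y0.
set i := Num.truncn y in t1 t2.
have iN : (i < n + n)%N.
  by rewrite -(ltr_nat R) natrD (le_lt_trans t1) // /y; lra.
have Ucell : cell del n i (on b o).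
  rewrite /cell /=; apply/andP; split.
    by rewrite -ler_pdivlMr // -/(U o); rewrite /y in t1; lra.
  rewrite -ltr_pdivrMr // -/(U o); rewrite /y -natr1 in t2; lra.
have Vcell : cell del n i (on (a s) o).
  apply: contrapT => nV; apply: nH.
  rewrite -(bigcup_mkord (n + n) (fun i => disagree (Z := Z) a b s (cell del n i))).
  by exists i => //=; left.
move: Ucell Vcell; rewrite /cell /= -/(U o) -/(V s o) => /andP[u1 u2] /andP[v1 v2].
rewrite ler_norml; apply/andP; split; nra.
Qed.

(** Expectations are taken in [quadratic_truncation], with [H] the event that some cell
    distinguishes the two sequences. By injectivity of the index maps, [V s] has the same fourth
    moment as [U]. *)
Lemma mean_square_approximation (e : R) : 0 < e -> exists N, forall s, (N <= s)%N ->
  rv_integrable P (fun o => (V s o - U o) ^+ 2) /\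
  \int[P]_o ((V s o - U o) ^+ 2) <= e.
Proof.
move=> e0.
have mU : measurable_fun setT U by exact: (functional_measurable iidZ _ mf).
have mV s : measurable_fun setT (V s) by exact: (functional_measurable iidZ _ mf).
have i2 : rv_integrable P (fun o => U o ^+ 2).
  exact: rv_square_integrable_fourth.
have pat s : same_pattern b b (a s) (a s).
  by move=> i j; split; rewrite (inj_eq injb) (inj_eq (@inja s)).
have mh : measurable_fun setT (fun x : R * R => x.1 ^+ 4).
  exact: measurable_funX.
have iV4 s : rv_integrable P (fun o => V s o ^+ 4).
  exact: (functional_pair_integrable iidZ mf mf (pat s) mh i4).
have EV4 s : \int[P]_o (V s o ^+ 4) = \int[P]_o (U o ^+ 4).
  by apply: esym; exact: (functional_pair_Rintegral iidZ mf mf (pat s) mh).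
set m4 := \int[P]_o (U o ^+ 4) in EV4; set m2 := \int[P]_o (U o ^+ 2).
have m40 : 0 <= m4.
  by apply: Rintegral_ge0 => o _; rewrite (_ : 4%N = (2 * 2)%N) // exprM sqr_ge0.
have m20 : 0 <= m2 by apply: Rintegral_ge0 => o _; exact: sqr_ge0.
(* Each of the four terms is to be at most [e / 4]. The constants are chosen in this order: [del];
   [C], for the fourth moments; [n], for large [U], using [n <= n ^+ 2]; and [N], giving
   [P H <= e / (4 * C)]. *)
pose del := Num.sqrt (e / 4).
have del2 : del ^+ 2 = e / 4 by rewrite sqr_sqrtr // divr_ge0 // ltW.
have d0 : 0 < del by rewrite sqrtr_gt0 divr_gt0.
pose C := 64 * (m4 + 1) / e.
have C0 : 0 < C by rewrite divr_gt0 // mulr_gt0 // ltr_wpDl.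
pose n := (Num.truncn (16 * C * m2 / e ^+ 2)).+1.
have nlt : 16 * C * m2 / e ^+ 2 < n%:R by exact: truncnS_gt.
have n1 : 1 <= n%:R :> R by rewrite ler1n.
have eC : 0 < e / (4 * C) by rewrite divr_gt0 // mulr_gt0.
have sc i : <<s @cylinders _ S nat >> (cell del n i).
  have mI : measurable [set x | (i%:R - n%:R) * del <= x < (i%:R - n%:R + 1) * del].
    have := measurable_itv `[(i%:R - n%:R) * del, (i%:R - n%:R + 1) * del[.
    by rewrite set_itvco.
  have := measurable_on_sequences_reindex (@id nat) mf measurableT mI.
  by rewrite setTI.
have [N hN] := @eventually_agree_finite _ _ _ _ _ P _ Z iidZ a b
  (cell del n) (n + n) sc
  (fun i => eventually_agree_sigma iidZ inja injb ab (sc i)) _ eC.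
exists N => s /hN {hN}; set H := \big[_/_]_(i < _) _ => PH.
have mH : measurable H.
  by apply: bigsetU_measurable => i _; exact: (disagree_measurable iidZ a b s (sc i)).
have PHr : fine (P H) <= e / (4 * C).
  by rewrite -lee_fin (fineK (fin_num_measure P _ mH)).
have iD : rv_integrable P (fun o => (V s o - U o) ^+ 2).
  apply: (@rv_integrable_le _ _ _ _ _ (fun o => 2 * V s o ^+ 2 + 2 * U o ^+ 2)).
  - by apply: measurable_funX; exact: measurable_funB.
  - by move=> o; rewrite ger0_norm ?sqr_ge0 //; have := sqr_ge0 (V s o + U o); nra.
  - apply: rv_integrableD; apply: rv_integrableZ => //.
    exact: rv_square_integrable_fourth.
split => //.
pose c1 := C / (n%:R * del) ^+ 2.
have j1 : rv_integrable P (fun o => c1 * U o ^+ 2) by exact: rv_integrableZ.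
have j2 : rv_integrable P (fun o => C * \1_H o).
  by apply: rv_integrableZ; exact: rv_integrable_indic.
have j3 : rv_integrable P (fun o => U o ^+ 4 + V s o ^+ 4) by exact: rv_integrableD.
have j4 : rv_integrable P (fun o => 8 / C * (U o ^+ 4 + V s o ^+ 4)).
  exact: rv_integrableZ.
have j0 := rv_integrable_cst P (del ^+ 2).
have j01 := rv_integrableD j0 j1; have j012 := rv_integrableD j01 j2.
apply: (@le_trans _ _ (\int[P]_o (del ^+ 2 + c1 * U o ^+ 2 + C * \1_H o +
    8 / C * (U o ^+ 4 + V s o ^+ 4)))).
  apply: rv_expect_le => //; first exact: rv_integrableD.
  move=> o; rewrite /c1 indicE mulrAC -mulrA.
  apply: quadratic_truncation => // Us; rewrite notin_setE => nH.
  exact: same_cell_close nH.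
rewrite (rv_expectD j012 j4) (rv_expectD j01 j2) (rv_expectD j0 j1).
rewrite rv_expect_cst !rv_expectZ //; last exact: rv_integrable_indic.
rewrite rv_expect_indic // rv_expectD // EV4 -/m4 -/m2.
have t1 : c1 * m2 <= e / 4.
  rewrite /c1 exprMn del2 mulrAC ler_pdivrMr; last first.
    by rewrite mulr_gt0 ?exprn_gt0 ?divr_gt0 // ltr0n.
  move: nlt; rewrite ltr_pdivrMr ?exprn_gt0 // => nlt.
  have : n%:R * e ^+ 2 <= n%:R ^+ 2 * e ^+ 2.
    by rewrite ler_wpM2r ?sqr_ge0 // -[X in X <= _]mulr1 expr2 ler_wpM2l // ltW // ltr0n.
  by nra.
have t2 : C * fine (P H) <= e / 4.
  apply: (@le_trans _ _ (C * (e / (4 * C)))); first by rewrite ler_wpM2l // ltW.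
  by rewrite le_eqVlt; apply/orP; left; apply/eqP; field; rewrite gt_eqF.
have t3 : 8 / C * (m4 + m4) <= e / 4.
  rewrite mulrAC ler_pdivrMr // /C.
  rewrite (_ : e / 4 * _ = 16 * (m4 + 1)); last by field; rewrite gt_eqF.
  by lra.
by rewrite del2; lra.
Qed.

End mean_square_approximation.

(** * Decay of the autocovariances *)

Section covariance_decay.
Context {R : realType} {dO dS : measure_display}
  {Omega : measurableType dO} {S : measurableType dS}.
Variable P : probability Omega R.
Variables (eps : int -> Omega -> S) (eps0' : Omega -> S).
Hypothesis iidZ : iid P (with_copy eps eps0').
Variable f : (nat -> S) -> R.
Hypothesis mf : measurable_on_sequences f.

Notation Z := (with_copy eps eps0').
Notation on w := (fun o i => Z (w i) o).

Lemma past_copyE t o : past_copy eps eps0' t o =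
  on (fun i => if t - i%:Z == 0 then None else Some (t - i%:Z)) o.
Proof. by apply/funext => i; rewrite /past_copy; case: ifP. Qed.

(* Four disjoint pools of innovations: [4 i] is shared by the two sequences
   compared, [4 i + 1] and [4 i + 2] are private to one of them, and [3] is the
   replacement of the first shared innovation.  The private pool [p] is [1] or
   [2]; the shared part starts at position [s]. *)
Definition share (p s i : nat) : option int :=
  Some (Posz (if (i < s)%N then 4 * i + p else 4 * (i - s))%N).

Definition share_copy (p s i : nat) : option int :=
  Some (Posz (if (i < s)%N then 4 * i + p else
              if i == s then 3 else 4 * (i - s))%N).

(** The limit of [share p s] as [s] grows: nothing is shared any more. *)
Definition private (p i : nat) : option int := Some (Posz (4 * i + p)%N).

Let phi w o := f (on w o).
Let shared_cov s u := \int[P]_o (phi (share 1 s) o * phi (share 2 u) o).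

Ltac same_index h k :=
  apply: k; first [discriminate h | try injection h as h;
    first [reflexivity | congr (Some (Posz _)); lia | congr Some; lia |
           exfalso; lia]].

(** Once all conditionals are split, each comparison of indices is linear arithmetic or a clash
    between [None] and [Some]. *)
Ltac pattern_lia := rewrite /share /share_copy /private;
  repeat match goal with
  | |- context [if ?b then _ else _] => let H := fresh in case H : b
  end;
  match goal with
  | |- (?a == ?b) = (?c == ?d) =>
    let h := fresh in let k := fresh in
    case: (a =P b) => h; case: (c =P d) => k; first [reflexivity | exfalso];
    first [same_index h k | same_index k h]
  end.

(** Index [3] replaces the shared index [0] in both sequences, so they still meet at the same
    positions. *)
Lemma share_pattern_copy s u :
  same_pattern (share 1 s) (share 2 u) (share_copy 1 s) (share_copy 2 u).
Proof. by move=> i j; split; pattern_lia. Qed.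

(** When only one sequence has its first shared innovation replaced, sharing starts one position
    later in both. *)
Lemma share_pattern_next1 s u :
  same_pattern (share 1 s) (share_copy 2 u) (share 1 s.+1) (share 2 u.+1).
Proof. by move=> i j; split; pattern_lia. Qed.

Lemma share_pattern_next2 s u :
  same_pattern (share_copy 1 s) (share 2 u) (share 1 s.+1) (share 2 u.+1).
Proof. by move=> i j; split; pattern_lia. Qed.

(** Position [s] of the past at time [s] is the innovation at time 0, the one replaced in
    [vartheta]. *)
Lemma past_pattern_copy p s : p \in [:: 1; 2]%N ->
  same_pattern (fun i => Some (s%:Z - i%:Z))
    (fun i => if s%:Z - i%:Z == 0 then None else Some (s%:Z - i%:Z))
    (share p s) (share_copy p s).
Proof. by rewrite !inE => ? i j; split; pattern_lia. Qed.

(** The later past starts with [t] innovations of its own and then runs through the earlier past. *)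
Lemma past_pattern_lag (tau : int) t :
  same_pattern (fun i => Some (tau - i%:Z)) (fun i => Some (tau + t%:Z - i%:Z))
    (share 1 0) (share 2 t).
Proof. by move=> i j; split; pattern_lia. Qed.

Lemma share_inj p s : p \in [:: 1; 2]%N -> injective (share p s).
Proof.
rewrite !inE => ? i j; rewrite /share.
by case: (ltnP i s); case: (ltnP j s) => ? ? -[]; lia.
Qed.

Lemma private_inj p : injective (private p).
Proof. by move=> i j -[]; lia. Qed.

Lemma share_copy_inj p s : p \in [:: 1; 2]%N -> injective (share_copy p s).
Proof.
rewrite !inE => ? i j; rewrite /share_copy => -[].
by case: (ltnP i s); case: (ltnP j s) => ? ?; case: (eqVneq i s);
  case: (eqVneq j s); lia.
Qed.

Lemma past_inj (t : int) : injective (fun i : nat => Some (t - i%:Z)).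
Proof. by move=> i j -[]; lia. Qed.

Hypothesis i4 : rv_integrable P (fun o => f (past eps 0 o) ^+ 4).
Hypothesis mean0 : \int[P]_o f (past eps 0 o) = 0.

Lemma past_law w : injective w ->
  same_pattern (fun i => Some (0 - i%:Z)) (fun i => Some (0 - i%:Z)) w w.
Proof.
by move=> injw i j; split; rewrite (inj_eq injw) (inj_eq (@past_inj 0)).
Qed.

Lemma phi_measurable w : measurable_fun setT (phi w).
Proof. exact: (functional_measurable iidZ _ mf). Qed.

Lemma phi_fourth w : injective w -> rv_integrable P (fun o => phi w o ^+ 4).
Proof.
move=> injw; have mh : measurable_fun setT (fun x : R * R => x.1 ^+ 4).
  exact: measurable_funX.
exact: (functional_pair_integrable iidZ mf mf (past_law injw) mh i4).
Qed.

Lemma phi_square w : injective w -> rv_integrable P (fun o => phi w o ^+ 2).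
Proof.
move=> injw; apply: rv_square_integrable_fourth; first exact: phi_measurable.
exact: phi_fourth.
Qed.

Lemma phi_square_mean w : injective w ->
  \int[P]_o (phi w o ^+ 2) = \int[P]_o (f (past eps 0 o) ^+ 2).
Proof.
move=> injw; have mh : measurable_fun setT (fun x : R * R => x.1 ^+ 2).
  exact: measurable_funX.
by rewrite (functional_pair_Rintegral iidZ mf mf (past_law injw) mh).
Qed.

Lemma phi_prod w v : injective w -> injective v ->
  rv_integrable P (fun o => phi w o * phi v o).
Proof.
move=> iw iv; apply: rv_integrable_prod; try exact: phi_measurable.
  exact: phi_square.
exact: phi_square.
Qed.

Lemma phi_diff_square w v : injective w -> injective v ->
  rv_integrable P (fun o => (phi w o - phi v o) ^+ 2).
Proof.
move=> iw iv.
apply: (@rv_integrable_le _ _ _ _ _ (fun o => 2 * phi w o ^+ 2 + 2 * phi v o ^+ 2)).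
- by apply: measurable_funX; apply: measurable_funB; exact: phi_measurable.
- by move=> o; rewrite ger0_norm ?sqr_ge0 //;
    have := sqr_ge0 (phi w o + phi v o); nra.
- by apply: rv_integrableD; apply: rv_integrableZ; exact: phi_square.
Qed.

Variables c beta : R.
Hypothesis beta01 : 0 < beta < 1.
Hypothesis dependence : forall s : nat,
  \int[P]_o ((f (past eps s%:Z o) - f (past_copy eps eps0' s%:Z o)) ^+ 2) <=
  c * (beta ^+ s) ^+ 2.

Lemma share_diff p s : p \in [:: 1; 2]%N ->
  \int[P]_o ((phi (share p s) o - phi (share_copy p s) o) ^+ 2) <=
  c * (beta ^+ s) ^+ 2.
Proof.
move=> hp; apply: le_trans (dependence s).
have mh : measurable_fun setT (fun x : R * R => (x.1 - x.2) ^+ 2).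
  by apply: measurable_funX; exact: measurable_funB.
have <- := functional_pair_Rintegral iidZ mf mf (past_pattern_copy s hp) mh.
rewrite le_eqVlt; apply/orP; left; apply/eqP; apply: eq_Rintegral => o _ /=.
by rewrite past_copyE.
Qed.

(* Resampling the first shared innovation in both sequences at once, the four
   products have means [cov], [next], [next], [cov], so that
   [E (x - x') (y - y') = 2 (cov - next)]. *)
Lemma shared_cov_step s u :
  `|shared_cov s u - shared_cov s.+1 u.+1| <= c / 2 * beta ^+ (s + u).
Proof.
have /andP[b0 _] := beta01.
have i1 := @share_inj 1 s isT; have i2 := @share_inj 2 u isT.
have j1 := @share_copy_inj 1 s isT; have j2 := @share_copy_inj 2 u isT.
pose x o := phi (share 1 s) o; pose x' o := phi (share_copy 1 s) o.
pose y o := phi (share 2 u) o; pose y' o := phi (share_copy 2 u) o.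
have mprod : measurable_fun setT (fun z : R * R => z.1 * z.2).
  exact: measurable_funM.
have e1 := functional_pair_Rintegral iidZ mf mf (share_pattern_copy s u) mprod.
have e2 := functional_pair_Rintegral iidZ mf mf (share_pattern_next1 s u) mprod.
have e3 := functional_pair_Rintegral iidZ mf mf (share_pattern_next2 s u) mprod.
rewrite /= in e1 e2 e3.
have E : \int[P]_o ((x o - x' o) * (y o - y' o)) =
    2 * (shared_cov s u - shared_cov s.+1 u.+1).
  transitivity (\int[P]_o (x o * y o - x o * y' o - (x' o * y o - x' o * y' o))).
    by apply: eq_Rintegral => o _; ring.
  have p1 := phi_prod i1 i2; have p2 := phi_prod i1 j2.
  have p3 := phi_prod j1 i2; have p4 := phi_prod j1 j2.
  rewrite (rv_expectB (rv_integrableB p1 p2) (rv_integrableB p3 p4)).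
  rewrite (rv_expectB p1 p2) (rv_expectB p3 p4).
  rewrite /x /y /x' /y' /phi e2 e3 -e1 /shared_cov /phi.
  by ring.
(* This weight in Young's inequality turns both mean squares, of orders [beta ^+ (2 * s)] and
   [beta ^+ (2 * u)], into [beta ^+ (s + u)]. *)
have k0 : 0 < beta ^+ u / beta ^+ s by rewrite divr_gt0 // exprn_gt0.
have mx : measurable_fun setT (fun o => x o - x' o).
  by apply: measurable_funB; exact: phi_measurable.
have my : measurable_fun setT (fun o => y o - y' o).
  by apply: measurable_funB; exact: phi_measurable.
have := rv_young k0 mx my (phi_diff_square i1 j1) (phi_diff_square i2 j2).
rewrite E normrM ger0_norm // => h.
have h1 := @share_diff 1 s isT; have h2 := @share_diff 2 u isT.
have : 2 * `|shared_cov s u - shared_cov s.+1 u.+1| <= c * beta ^+ (s + u).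
  apply: (le_trans h).
  apply: (@le_trans _ _ ((beta ^+ u / beta ^+ s * (c * (beta ^+ s) ^+ 2) +
      (beta ^+ u / beta ^+ s)^-1 * (c * (beta ^+ u) ^+ 2)) / 2)).
    by rewrite ler_pM2r ?invr_gt0 // lerD // ler_wpM2l // ltW // invr_gt0.
  rewrite le_eqVlt; apply/orP; left; apply/eqP; rewrite exprD; field.
  by rewrite !expf_neq0 // gt_eqF.
by lra.
Qed.

(** Along the diagonal, the step at [s] costs [c / 2 * beta ^+ t * (beta ^+ 2) ^+ s], and these
    costs form a geometric series. *)
Lemma shared_cov_telescope s t :
  `|shared_cov 0 t - shared_cov s (s + t)| <=
  c / 2 * beta ^+ t * ((1 - (beta ^+ 2) ^+ s) / (1 - beta ^+ 2)).
Proof.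
have /andP[b0 b1] := beta01.
have b2 : 0 < 1 - beta ^+ 2 by rewrite subr_gt0 expr_lt1 // ltW.
elim: s => [|s IH]; first by rewrite add0n subrr normr0 expr0 subrr mul0r mulr0.
rewrite addSn -(subrKA (shared_cov s (s + t))).
apply: (le_trans (ler_normD _ _)); apply: (le_trans (lerD IH (shared_cov_step _ _))).
rewrite le_eqVlt; apply/orP; left; apply/eqP.
rewrite [in RHS](exprS (beta ^+ 2) s) (exprAC beta 2 s) !exprD.
by field; rewrite gt_eqF.
Qed.

(** Pool 1 is disjoint from the pools read by [share 2 u], and the second factor is centered. *)
Lemma private_share_independent u :
  \int[P]_o (phi (private 1) o * phi (share 2 u) o) = 0.
Proof.
have i1 := @private_inj 1; have i2 := @share_inj 2 u isT.
apply: (functional_independent_prod iidZ mf mf).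
- move=> i j; apply/eqP; rewrite /private /share.
  by case: ltnP => _ -[]; lia.
- exact: phi_prod.
- apply: (@rv_integrable_le _ _ _ _ _ (fun o => 1 + phi (share 2 u) o ^+ 2)).
  + exact: phi_measurable.
  + by move=> o; rewrite ler_norml; apply/andP; split;
      rewrite -/(phi (share 2 u) o); nra.
  + by apply: rv_integrableD; [exact: rv_integrable_cst|exact: phi_square].
- have mh : measurable_fun setT (fun x : R * R => x.1) by exact: measurable_fst.
  by rewrite -(functional_pair_Rintegral iidZ mf mf (past_law i2) mh).
Qed.

(** Replacing [share 1 s] by [private 1] makes the mean of the product zero, and for large [s] it
    changes the first factor little in mean square. *)
Lemma shared_cov_vanish t (e : R) : 0 < e ->
  exists s, `|shared_cov s (s + t)| <= e.
Proof.
move=> e0; have i1 := @private_inj 1.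
pose m2 := \int[P]_o (f (past eps 0 o) ^+ 2).
have m20 : 0 <= m2 by apply: Rintegral_ge0 => o _; exact: sqr_ge0.
(* With this weight the second term of Young's inequality is at most [e]; approximation to accuracy
   [e / k] does the same for the first. *)
pose k := (m2 + 1) / e; have k0 : 0 < k by rewrite divr_gt0 // ltr_wpDl.
have ek : 0 < e / k by rewrite divr_gt0.
have agree s i : (i < s)%N -> share 1 s i = private 1 i.
  by rewrite /share => ->.
have [s /(_ _ (leqnn s)) [iD hs]] := mean_square_approximation iidZ
  (fun s => @share_inj 1 s isT) i1 agree mf (phi_fourth i1) ek.
exists s; have i2 := @share_inj 2 (s + t) isT.
have js := @share_inj 1 s isT.
have -> : shared_cov s (s + t) = \int[P]_o ((phi (share 1 s) o -
    phi (private 1) o) * phi (share 2 (s + t)) o).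
  transitivity (\int[P]_o (phi (share 1 s) o * phi (share 2 (s + t)) o -
      phi (private 1) o * phi (share 2 (s + t)) o)).
    rewrite (rv_expectB (phi_prod js i2) (phi_prod i1 i2)).
    by rewrite private_share_independent subr0.
  by apply: eq_Rintegral => o _; ring.
have mD : measurable_fun setT (fun o => phi (share 1 s) o - phi (private 1) o).
  by apply: measurable_funB; exact: phi_measurable.
apply: (le_trans (rv_young k0 mD (phi_measurable _) iD (phi_square i2))).
rewrite phi_square_mean // -/m2.
have h1 : k * \int[P]_o (phi (share 1 s) o - phi (private 1) o) ^+ 2 <= e.
  by rewrite mulrC -ler_pdivlMr.
have h2 : k^-1 * m2 <= e.
  rewrite /k invf_div mulrAC ler_pdivrMr ?ltr_wpDl // ler_pM2l //.
  by lra.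
by lra.
Qed.

Lemma covariance_decay (tau : int) (t : nat) :
  `|\int[P]_o (f (past eps tau o) * f (past eps (tau + t%:Z) o))| <=
  c / 2 / (1 - beta ^+ 2) * beta ^+ t.
Proof.
have /andP[b0 b1] := beta01.
have b2 : 0 < 1 - beta ^+ 2 by rewrite subr_gt0 expr_lt1 // ltW.
have c0 : 0 <= c.
  have := dependence 0; rewrite expr0 expr1n mulr1; apply: le_trans.
  by apply: Rintegral_ge0 => o _; exact: sqr_ge0.
have mprod : measurable_fun setT (fun z : R * R => z.1 * z.2).
  exact: measurable_funM.
have -> : \int[P]_o (f (past eps tau o) * f (past eps (tau + t%:Z) o)) =
    shared_cov 0 t.
  by have := functional_pair_Rintegral iidZ mf mf (past_pattern_lag tau t) mprod.
(* Telescope up to a level [s] where the remaining covariance is at most [e]; the telescoping bound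
   is uniform in [s]. *)
apply/ler_addgt0Pr => e e0.
have [s hs] := shared_cov_vanish t e0.
rewrite -(subrK (shared_cov s (s + t)) (shared_cov 0 t)).
apply: (le_trans (ler_normD _ _)); apply: lerD hs.
apply: (le_trans (shared_cov_telescope s t)).
rewrite -mulrA [leRHS]mulrAC -[leRHS]mulrA ler_wpM2l ?divr_ge0 //.
rewrite ler_wpM2l ?exprn_ge0 ?(ltW b0) //.
rewrite ler_pdivrMr // mulVf ?gt_eqF //.
by rewrite lerBlDr lerDl exprn_ge0 // exprn_ge0 // ltW.
Qed.

End covariance_decay.

(** * Partial sums, long-run variances and power means *)

Section weak_dependence_sums.
Context {R : realType} {d : measure_display} {Omega : measurableType d}.
Variable P : probability Omega R.
Variables (x : nat -> Omega -> R) (K beta : R).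
Hypothesis beta01 : 0 < beta < 1.
Hypothesis mx : forall i, measurable_fun setT (x i).
Hypothesis x2 : forall i, rv_integrable P (fun o => x i o ^+ 2).
Hypothesis cov : forall i t,
  `|\int[P]_o (x i o * x (i + t)%N o)| <= K * beta ^+ t.

Let sum n o := \sum_(i < n) x i o.

Lemma partial_sum_measurable n : measurable_fun setT (sum n).
Proof. exact: measurable_sum. Qed.

Lemma partial_sum_square n : rv_integrable P (fun o => sum n o ^+ 2).
Proof.
elim: n => [|n IH].
  rewrite (_ : (fun o => _) = fun=> 0); first exact: rv_integrable_cst.
  by apply/funext => o; rewrite /sum big_ord0 expr0n.
apply: (@rv_integrable_le _ _ _ _ _ (fun o => 2 * sum n o ^+ 2 + 2 * x n o ^+ 2)).
- by apply: measurable_funX; exact: partial_sum_measurable.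
- move=> o; rewrite ger0_norm ?sqr_ge0 // /sum big_ord_recr /= -/(sum n o).
  by have := sqr_ge0 (sum n o - x n o); nra.
- by apply: rv_integrableD; exact: rv_integrableZ.
Qed.

(** The lags [m - i] with [i < n] are at least [m - n + 1]. Bounding by the full geometric tail
    instead of the finite sum makes the induction step an equality. *)
Lemma partial_sum_cov n m : (n <= m)%N ->
  `|\int[P]_o (sum n o * x m o)| <= K * (beta ^+ (m - n).+1 / (1 - beta)).
Proof.
have /andP[b0 b1] := beta01.
have K0 : 0 <= K.
  by have := cov 0 0; rewrite expr0 mulr1; apply: le_trans; exact: normr_ge0.
have b10 : 0 < 1 - beta by rewrite subr_gt0.
elim: n => [|n IH] nm.
  have -> : \int[P]_o (sum 0 o * x m o) = 0.
    rewrite -[RHS](rv_expect_cst P 0); apply: eq_Rintegral => o _.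
    by rewrite /sum big_ord0 mul0r.
  by rewrite normr0 mulr_ge0 // divr_ge0 ?exprn_ge0 // ltW.
have -> : \int[P]_o (sum n.+1 o * x m o) =
    \int[P]_o (sum n o * x m o + x n o * x m o).
  by apply: eq_Rintegral => o _; rewrite /sum big_ord_recr /= mulrDl.
rewrite rv_expectD; last 2 first.
- by apply: rv_integrable_prod => //; [exact: partial_sum_measurable|
    exact: partial_sum_square].
- exact: rv_integrable_prod.
apply: (le_trans (ler_normD _ _)).
have h := cov n (m - n); rewrite (subnKC (ltnW nm)) in h.
apply: (le_trans (lerD (IH (ltnW nm)) h)).
rewrite -mulrDr ler_wpM2l // subnSK //.
rewrite le_eqVlt; apply/orP; left; apply/eqP.
by rewrite exprS; field; rewrite gt_eqF.
Qed.

(** Each new term adds at most [K] for its square and [2 * K * beta / (1 - beta)] for its covariance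
    with the past, in total at most [2 * K / (1 - beta)]. *)
Lemma partial_sum_variance n :
  \int[P]_o (sum n o ^+ 2) <= n%:R * (2 * K / (1 - beta)).
Proof.
have /andP[b0 b1] := beta01.
have b10 : 0 < 1 - beta by rewrite subr_gt0.
have K0 : 0 <= K.
  by have := cov 0 0; rewrite expr0 mulr1; apply: le_trans; exact: normr_ge0.
elim: n => [|n IH].
  rewrite mul0r le_eqVlt -[X in _ == X](rv_expect_cst P 0); apply/orP; left.
  by apply/eqP/eq_Rintegral => o _; rewrite /sum big_ord0 expr0n.
have ip : rv_integrable P (fun o => sum n o * x n o).
  by apply: rv_integrable_prod => //; [exact: partial_sum_measurable|
    exact: partial_sum_square].
have -> : \int[P]_o (sum n.+1 o ^+ 2) =
    \int[P]_o (sum n o ^+ 2 + 2 * (sum n o * x n o) + x n o ^+ 2).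
  by apply: eq_Rintegral => o _; rewrite /sum big_ord_recr /=; ring.
have i2 := partial_sum_square n; have i2p := rv_integrableZ 2 ip.
rewrite (rv_expectD (rv_integrableD i2 i2p) (x2 n)) (rv_expectD i2 i2p).
rewrite (rv_expectZ 2 ip).
have h1 := le_trans (ler_norm _) (partial_sum_cov (leqnn n)).
have h2 := le_trans (ler_norm _) (cov n 0).
rewrite subnn expr1 in h1; rewrite addn0 expr0 mulr1 in h2.
have h3 : \int[P]_o (x n o ^+ 2) <= K.
  by apply: le_trans h2; rewrite le_eqVlt; apply/orP; left; apply/eqP;
    apply: eq_Rintegral => o _; rewrite expr2.
have h4 : 2 * (K * (beta / (1 - beta))) + K <= 2 * K / (1 - beta).
  rewrite -(ler_pM2r b10) mulrDl divfK ?gt_eqF //.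
  rewrite (_ : 2 * (K * (beta / (1 - beta))) * (1 - beta) = 2 * K * beta).
    by nra.
  by field; rewrite gt_eqF.
by rewrite -natr1 mulrDl mul1r; lra.
Qed.

(** Chebyshev's inequality. *)
Lemma partial_sum_deviation n (l : R) : 0 < l ->
  (P [set o | (l < `|sum n o|)%R] <=
   (n%:R * (2 * K / (1 - beta)) / l ^+ 2)%:E)%E.
Proof.
move=> l0; set A := [set o | _].
have mA : measurable A.
  rewrite (_ : A = (fun o => `|sum n o|) @^-1` `]l, +oo[); last first.
    by apply/seteqP; split => o; rewrite /A /= in_itv /= andbT.
  rewrite -[X in measurable X]setTI.
  have := partial_sum_measurable n => ms.
  by apply: (measurableT_comp (@normr_measurable R setT) ms) => //; exact: measurable_itv.
rewrite -(fineK (fin_num_measure P _ mA)) lee_fin -rv_expect_indic //.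
rewrite ler_pdivlMr ?exprn_gt0 // mulrC -rv_expectZ; last exact: rv_integrable_indic.
apply: le_trans (partial_sum_variance n); apply: rv_expect_le.
- by apply: rv_integrableZ; exact: rv_integrable_indic.
- exact: partial_sum_square.
- move=> o; rewrite indicE; case: (boolP (o \in A)) => [|_]; last first.
    by rewrite mulr0 sqr_ge0.
  rewrite inE /A /= mulr1 => h.
  rewrite -[X in _ <= X]real_normK ?num_real // ler_sqr ?nnegrE ?(ltW l0) //.
  exact: ltW.
Qed.

End weak_dependence_sums.

Section absolute_summation.
Context {R : realType}.

Lemma esum_geometric_nat (K beta : R) : 0 <= K -> 0 < beta < 1 ->
  (\esum_(n in [set: nat]) (K * beta ^+ n)%:E <= (K / (1 - beta))%:E)%E.
Proof.
move=> K0 /andP[b0 b1]; have b10 : 0 < 1 - beta by rewrite subr_gt0.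
have p n : 0 <= K * beta ^+ n by rewrite mulr_ge0 // exprn_ge0 // ltW.
rewrite -nneseries_esumT; last by move=> n; rewrite lee_fin.
apply: lime_le; first by apply: is_cvg_nneseries => n _ _; rewrite lee_fin.
apply: nearW => n; rewrite sumEFin lee_fin big_mkord.
rewrite -mulr_sumr ler_wpM2l // -[leRHS]mul1r ler_pdivlMr //.
have -> : (\sum_(i < n) beta ^+ i) * (1 - beta) = 1 - beta ^+ n.
  by rewrite -[RHS]opprB (subrX1 beta n); ring.
by rewrite lerBlDr lerDl exprn_ge0 // ltW.
Qed.

Lemma esum_geometric_int (K beta : R) : 0 <= K -> 0 < beta < 1 ->
  (\esum_(t in [set: int]) (K * beta ^+ `|t|%N)%:E <= (2 * K / (1 - beta))%:E)%E.
Proof.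
move=> K0 b01; have /andP[b0 b1] := b01.
have p n : 0 <= K * beta ^+ n by rewrite mulr_ge0 // exprn_ge0 // ltW.
rewrite (esumID (range Posz)) => [|t _]; last by rewrite lee_fin.
have -> : 2 * K / (1 - beta) = K / (1 - beta) + K / (1 - beta) by ring.
rewrite EFinD; apply: leeD.
  rewrite setTI esum_image; last by move=> i j _ _ [].
  exact: esum_geometric_nat.
rewrite setTI (_ : ~` range Posz = range Negz); last first.
  apply/seteqP; split => [[n|n]|_ [n _ <-] [k _]] //= h; last by exists n.
  by case: h; exists n.
rewrite esum_image; last by move=> i j _ _ [].
(* [Negz n] is [- (n + 1)], so its weight [beta ^+ n.+1] is at most [beta ^+ n]. *)
apply: le_trans (esum_geometric_nat K0 b01); apply: le_esum => n _ /=.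
rewrite lee_fin ler_wpM2l // exprS -[leRHS]mul1r ler_wpM2r ?exprn_ge0 //; exact: ltW.
Qed.

(** An upper bound on [c] suffices: negative parts only lower the sum, and if they diverge, [fine]
    returns 0, which the bound also dominates. *)
Lemma sumZ_le (c : int -> \bar R) (K beta : R) : 0 <= K -> 0 < beta < 1 ->
  (forall t, (c t <= (K * beta ^+ `|t|%N)%:E)%E) ->
  fine (sumZ c) <= 2 * K / (1 - beta).
Proof.
move=> K0 b01 hc; have /andP[b0 b1] := b01.
have p n : 0 <= K * beta ^+ n by rewrite mulr_ge0 // exprn_ge0 // ltW.
have ub0 : 0 <= 2 * K / (1 - beta).
  by rewrite divr_ge0 ?mulr_ge0 // subr_ge0 ltW.
have pos : (\esum_(t in setT) (c^\+ t) <= (2 * K / (1 - beta))%:E)%E.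
  apply: le_trans (esum_geometric_int K0 b01); apply: le_esum => t _.
  by rewrite funeposE ge_max hc lee_fin p.
have pos0 : (0 <= \esum_(t in setT) (c^\+ t))%E.
  by apply: esum_ge0 => t _; exact: funepos_ge0.
have neg0 : (0 <= \esum_(t in setT) (c^\- t))%E.
  by apply: esum_ge0 => t _; exact: funeneg_ge0.
rewrite /sumZ; move: pos pos0 neg0.
case: (\esum_(t in setT) (c^\+ t))%E => [u| |] //=.
case: (\esum_(t in setT) (c^\- t))%E => [v| |] //=.
by rewrite !lee_fin; lra.
Qed.

End absolute_summation.

Section power_means.
Context {R : realType} {d : measure_display} {Omega : measurableType d}.
Variable P : probability Omega R.

Lemma fourth_power_le_powR (p y : R) : 4 <= p -> y ^+ 4 <= 1 + `|y| `^ p.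
Proof.
move=> p4; rewrite (_ : y ^+ 4 = `|y| ^+ 4); last first.
  by rewrite (_ : 4%N = (2 * 2)%N) // !exprM real_normK // num_real.
have [y1|y1] := leP `|y| 1.
  by rewrite -[leLHS]addr0 lerD ?powR_ge0 // exprn_ile1.
rewrite -[leLHS]add0r lerD // -powR_mulrn // ler_powR // ltW //.
Qed.

Lemma square_le_powR (p y : R) : 4 <= p -> y ^+ 2 <= 1 + `|y| `^ p.
Proof.
move=> p4; rewrite -[y ^+ 2]real_normK ?num_real //.
have [y1|y1] := leP `|y| 1.
  by rewrite -[leLHS]addr0 lerD ?powR_ge0 // exprn_ile1.
rewrite -[leLHS]add0r lerD // -powR_mulrn // ler_powR //; last by lra.
exact: ltW.
Qed.

Lemma Lnorm_powR_integral (f : Omega -> R) (p : R) : 0 < p ->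
  ('N[P]_(p%:E)[EFin \o f] `^ p = \int[P]_o (`|f o| `^ p)%:E)%E.
Proof. by move=> p0; rewrite poweR_Lnorm ?gt_eqF. Qed.

Lemma powR_norm_measurable (f : Omega -> R) (p : R) :
  measurable_fun setT f -> measurable_fun setT (fun o => `|f o| `^ p).
Proof.
move=> mf; apply: (measurableT_comp (measurable_powR p)).
exact: measurableT_comp.
Qed.

Lemma Lnorm_powR_integrable (f : Omega -> R) (p : R) : 0 < p ->
  measurable_fun setT f -> ('N[P]_(p%:E)[EFin \o f] < +oo)%E ->
  rv_integrable P (fun o => `|f o| `^ p).
Proof.
move=> p0 mf fin; apply/integrableP; split.
  exact/measurable_EFinP/powR_norm_measurable.
rewrite (_ : \int[_]_x _ = \int[P]_o (`|f o| `^ p)%:E)%E; last first.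
  by apply: eq_integral => o _; rewrite gee0_abs // lee_fin powR_ge0.
by rewrite -Lnorm_powR_integral // poweR_lty.
Qed.

Lemma Lnorm_fourth_integrable (f : Omega -> R) (p : R) : 4 <= p ->
  measurable_fun setT f -> ('N[P]_(p%:E)[EFin \o f] < +oo)%E ->
  rv_integrable P (fun o => f o ^+ 4).
Proof.
move=> p4 mf fin; apply: (@rv_integrable_le _ _ _ _ _ (fun o => 1 + `|f o| `^ p)).
- exact: measurable_funX.
- move=> o; rewrite ger0_norm ?fourth_power_le_powR //.
  by rewrite (_ : 4%N = (2 * 2)%N) // exprM sqr_ge0.
- apply: rv_integrableD; first exact: rv_integrable_cst.
  by apply: Lnorm_powR_integrable => //; lra.
Qed.

(* Young's inequality after scaling by the norm: no monotonicity of the norms in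
   the exponent is needed at the price of a factor 2. *)
Lemma Lnorm_square_le (f : Omega -> R) (p k : R) : 4 <= p -> 0 < k ->
  measurable_fun setT f -> ('N[P]_(p%:E)[EFin \o f] <= k%:E)%E ->
  \int[P]_o (f o ^+ 2) <= 2 * k ^+ 2.
Proof.
move=> p4 k0 mf le; have p0 : 0 < p by lra.
have fin : ('N[P]_(p%:E)[EFin \o f] < +oo)%E by rewrite (le_lt_trans le) // ltry.
have ip := Lnorm_powR_integrable p0 mf fin.
have kp0 : 0 < k `^ p by exact: powR_gt0.
have Ep : \int[P]_o (`|f o| `^ p) <= k `^ p.
  rewrite -lee_fin /Rintegral fineK; last exact: integrable_fin_num.
  rewrite -Lnorm_powR_integral //.
  apply: (@le_trans _ _ (k%:E `^ p)%E) => //.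
  by apply: gt0_ler_poweR; rewrite ?in_itv /= ?leey ?Lnorm_ge0 ?lee_fin ?(ltW k0) ?(ltW p0).
have ub o : f o ^+ 2 <= k ^+ 2 + k ^+ 2 / (k `^ p) * `|f o| `^ p.
  have := square_le_powR (f o / k) p4.
  have kV : k^-1 `^ p = (k `^ p)^-1.
    by rewrite -(powR_inv1 (ltW k0)) -powRrM mulN1r powRN.
  rewrite normrM normfV (gtr0_norm k0) powRM ?invr_ge0 ?(ltW k0) // kV.
  rewrite expr_div_n ler_pdivrMr ?exprn_gt0 // => h.
  by apply: (le_trans h); rewrite le_eqVlt; apply/orP; left; apply/eqP; ring.
have i0 := rv_integrable_cst P (k ^+ 2).
have i1 := rv_integrableZ (k ^+ 2 / (k `^ p)) ip.
apply: (@le_trans _ _ (\int[P]_o (k ^+ 2 + k ^+ 2 / (k `^ p) * `|f o| `^ p))).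
  apply: rv_expect_le => //; last exact: rv_integrableD.
  apply: rv_integrable_le (rv_integrableD i0 i1); first exact: measurable_funX.
  by move=> o; rewrite ger0_norm ?sqr_ge0.
rewrite (rv_expectD i0 i1) rv_expect_cst rv_expectZ //.
have : k ^+ 2 / (k `^ p) * \int[P]_o (`|f o| `^ p) <= k ^+ 2.
  by rewrite mulrAC ler_pdivrMr // ler_wpM2l // sqr_ge0.
by lra.
Qed.

End power_means.

(** * Bounds on the test statistic *)

Section statistic_measurability.
Context {R : realType} {dO : measure_display} {Omega : measurableType dO}.

(** The inverse is [x] times a real power of [x ^+ 2]; at 0 both sides vanish because [0^-1 = 0]. *)
Lemma measurable_inverse : measurable_fun setT (fun x : R => x^-1).
Proof.
rewrite (_ : (fun x => _) = fun x : R => x * (x ^+ 2) `^ (-1)).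
  apply: measurable_funM => //.
  apply: (measurableT_comp (measurable_powR (-1))).
  exact: measurable_funX.
apply/funext => x; rewrite powR_inv1 ?sqr_ge0 //.
have [->|x0] := eqVneq x 0; first by rewrite invr0 mul0r.
by rewrite expr2 invfM mulrA divff // mul1r.
Qed.

Lemma measurable_bigmaxe (r : seq nat) (F : nat -> Omega -> \bar R) :
  (forall i, i \in r -> measurable_fun setT (F i)) ->
  measurable_fun setT (fun w => \big[maxe/-oo%E]_(i <- r) F i w).
Proof.
elim: r => [|i r IH] mF.
  by under eq_fun do rewrite big_nil; exact: measurable_cst.
under eq_fun do rewrite big_cons.
apply: measurable_maxe; first by apply: mF; rewrite mem_head.
by apply: IH => j jr; apply: mF; rewrite inE jr orbT.
Qed.

Variables (X : int -> nat -> Omega -> R) (shat : nat -> Omega -> R).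
Variables (m d Tm : nat).
Hypothesis mX : forall t h, (0 < h)%N -> measurable_fun setT (X t h).
Hypothesis mshat : forall h, (1 <= h <= d)%N -> measurable_fun setT (shat h).

Lemma sample_mean_measurable i j h : (0 < h)%N ->
  measurable_fun setT (sample_mean X i j h).
Proof.
move=> h0; apply: measurable_funM => //.
by apply: measurable_sum => t; exact: mX.
Qed.

Lemma max_stat_measurable : measurable_fun setT (max_stat X shat m d Tm).
Proof.
apply: measurable_bigmaxe => k _; apply: measurable_bigmaxe => h.
rewrite mem_index_iota ltnS => hd; have /andP[h0 _] := hd.
apply: measurable_bigmaxe => j _; apply/measurable_EFinP.
apply: measurable_funM; last first.
  by apply: measurableT_comp => //; apply: measurable_funB;
    exact: sample_mean_measurable.
apply: measurable_funM => //; apply: measurable_funM => //.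
apply: (measurableT_comp measurable_inverse).
by apply: measurable_funM => //; exact: mshat.
Qed.

Lemma max_sd_error_measurable (s : nat -> R) :
  measurable_fun setT (max_sd_error shat s d).
Proof.
apply: measurable_bigmaxe => h; rewrite mem_index_iota ltnS => hd.
apply/measurable_EFinP; apply: measurableT_comp => //.
by apply: measurable_funB => //; exact: mshat.
Qed.

Lemma initial_sample_measurable (n c : nat) :
  measurable_fun setT (initial_sample X n c).
Proof.
apply/measurable_fun_tnthP => t.
rewrite (_ : _ \o _ = fun w => [tuple X (t.+1)%:Z h.+1 w | h < c]); last first.
  by apply/funext => w /=; rewrite tnth_mktuple.
apply/measurable_fun_tnthP => h.
rewrite (_ : _ \o _ = X (t.+1)%:Z h.+1); first exact: mX.
by apply/funext => w /=; rewrite tnth_mktuple.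
Qed.

Lemma max_stat_ge k h j w : (1 <= k <= Tm)%N -> (1 <= h <= d)%N -> (j < k)%N ->
  ((1 / (1 + k%:R / m%:R) * ((k - j)%:R / (Num.sqrt m%:R * shat h w)) *
       `|sample_mean X (m + j + 1) (m + k) h w
         - sample_mean X 1 (m + j) h w|)%:E <= max_stat X shat m d Tm w)%E.
Proof.
move=> hk hh hj; apply: (bigmax_sup_seq _ k) => //.
  by rewrite mem_index_iota ltnS.
apply: (bigmax_sup_seq _ h) => //; first by rewrite mem_index_iota ltnS.
by apply: (bigmax_sup_seq _ j) => //; rewrite mem_index_iota.
Qed.

Lemma max_sd_error_ge s h w : (1 <= h <= d)%N ->
  (`|shat h w - s h|%:E <= max_sd_error shat s d w)%E.
Proof.
by move=> hh; apply: (bigmax_sup_seq _ h) => //; rewrite mem_index_iota ltnS.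
Qed.

End statistic_measurability.

Section deterministic_bounds.
Context {R : realType}.

(** After multiplication by [n2], the signal is at least [c * M * |Delta|], and the noise at most
    [(1 + T) * l * sqrt M] because [n2 / n1 <= T]. Nonnegativity of the net signal allows [s] to be
    replaced by [smax]. *)
Lemma signal_minus_noise (M T Delta S1 S2 n1 n2 s smax l c : R) :
  0 < M -> 0 < T -> M <= n1 -> 0 < c -> c * M <= n2 -> n2 <= T * M ->
  0 < s -> s <= smax -> `|S1| <= l * Num.sqrt M -> `|S2| <= l * Num.sqrt M ->
  0 <= c * (Num.sqrt M * `|Delta|) - (1 + T) * l ->
  (c * (Num.sqrt M * `|Delta|) - (1 + T) * l) / ((1 + T) * smax) <=
  1 / (1 + T) * (n2 / (Num.sqrt M * s)) * `|Delta + S2 / n2 - S1 / n1|.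
Proof.
move=> M0 T0 Mn1 c0 cn2 n2T s0 ssm h1 h2; set Q := _ - _ => Q0.
have rM0 : 0 < Num.sqrt M by rewrite sqrtr_gt0.
have rM2 : Num.sqrt M * Num.sqrt M = M by rewrite -expr2 sqr_sqrtr // ltW.
have n20 : 0 < n2 by rewrite (lt_le_trans _ cn2) // mulr_gt0.
have n10 : 0 < n1 by rewrite (lt_le_trans _ Mn1).
have T10 : 0 < 1 + T by rewrite addr_gt0.
have Qle : Num.sqrt M * Q <= n2 * `|Delta + S2 / n2 - S1 / n1|.
  rewrite -[X in X * `|_|](gtr0_norm n20) -normrM.
  have -> : n2 * (Delta + S2 / n2 - S1 / n1) = n2 * Delta + (S2 - n2 / n1 * S1).
    by field; rewrite !gt_eqF.
  have r1 : n2 / n1 <= T.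
    rewrite ler_pdivrMr //; apply: (le_trans n2T); rewrite ler_wpM2l //; exact: ltW.
  have r0 : 0 <= n2 / n1 by rewrite divr_ge0 // ltW.
  have b1 : `|n2 / n1 * S1| <= T * (l * Num.sqrt M).
    by rewrite normrM (ger0_norm r0) ler_pM.
  have b2 := ler_normB S2 (n2 / n1 * S1).
  have b3 := lerB_normD (n2 * Delta) (S2 - n2 / n1 * S1).
  rewrite [`|n2 * Delta|]normrM (gtr0_norm n20) in b3.
  have b4 : c * M * `|Delta| <= n2 * `|Delta| by rewrite ler_wpM2r.
  have -> : Num.sqrt M * Q =
      c * (Num.sqrt M * Num.sqrt M) * `|Delta| - (1 + T) * (l * Num.sqrt M).
    by rewrite /Q; ring.
  rewrite rM2.
  by lra.
have s1 : 0 < smax by exact: lt_le_trans ssm.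
rewrite (_ : 1 / (1 + T) * (n2 / (Num.sqrt M * s)) * _ =
   n2 * `|Delta + S2 / n2 - S1 / n1| / ((1 + T) * (Num.sqrt M * s))); last first.
  by field; rewrite !gt_eqF.
apply: (@le_trans _ _ (Num.sqrt M * Q / ((1 + T) * (Num.sqrt M * s)))); last first.
  by rewrite ler_pM2r // invr_gt0 !mulr_gt0.
have -> : Num.sqrt M * Q / ((1 + T) * (Num.sqrt M * s)) = Q / ((1 + T) * s).
  by field; rewrite !gt_eqF.
by rewrite ler_wpM2l // lef_pV2 ?posrE ?mulr_gt0 // ler_pM2l.
Qed.

(** (D1) places [ln d] between [ln m / C_D] and [(D + 1) * ln m]. The lower bounds on [ln m] give
    [ln d >= 1 + 16 / pi], so that [norm_a] is at least 1 and the term subtracted in [norm_b] is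
    nonnegative. *)
Lemma threshold_le (T D C_D x : R) (m d : nat) : 0 < T -> 0 < D -> 0 < C_D ->
  1 <= ln m%:R :> R -> ln C_D <= ln m%:R -> C_D * (1 + 16 / pi) <= ln m%:R ->
  m%:R `^ (C_D^-1) <= d%:R <= C_D * m%:R `^ D ->
  x / norm_a T d + norm_b T d <=
    (`|x| + Num.sqrt (2 * (D + 1))) * Num.sqrt (ln m%:R).
Proof.
move=> T0 D0 C0; set L : R := ln m%:R => L1 LC LC2 /andP[d1 d2].
have m0 : 0 < m%:R :> R.
  by rewrite ltNge; apply/negP => /ln0; rewrite -/L => e; move: L1; rewrite e ler10.
have dpos : 0 < d%:R :> R by rewrite (lt_le_trans _ d1) // powR_gt0.
set l : R := ln d%:R.
have pi0 : 0 < pi :> R := pi_gt0 R.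
have p16 : 0 < 16 / pi :> R by rewrite divr_gt0.
have l1 : L / C_D <= l.
  by rewrite /l mulrC -ln_powR ler_ln // posrE powR_gt0.
have l2 : l <= (D + 1) * L.
  have : l <= ln (C_D * m%:R `^ D).
    by rewrite /l ler_ln // posrE ?mulr_gt0 // powR_gt0.
  by rewrite lnM ?posrE ?powR_gt0 // ln_powR -/L => h; lra.
have l3 : 1 + 16 / pi <= l.
  by apply: le_trans l1; rewrite ler_pdivlMr // mulrC.
have l0 : 1 <= l by lra.
have lpos : 0 < l by lra.
have q0 : 0 < qT T by rewrite /qT divr_gt0 // addr_gt0.
have q1 : qT T <= 1 by rewrite /qT ler_pdivrMr ?mul1r ?addr_gt0 //; lra.
have sL : 1 <= Num.sqrt L by rewrite -[X in X <= _]sqrtr1 ler_wsqrtr.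
have a1 : 1 <= norm_a T d.
  rewrite /norm_a -[X in X <= _]sqrtr1 ler_wsqrtr // ler_pdivlMr // mul1r -/l; lra.
have t1 : x / norm_a T d <= `|x| * Num.sqrt L.
  apply: le_trans (ler_norm _) _; rewrite normrM ler_wpM2l // normfV.
  rewrite ger0_norm; last by lra.
  by apply: le_trans sL; rewrite invf_le1 //; lra.
have t2 : norm_b T d <= Num.sqrt (2 * (D + 1)) * Num.sqrt L.
  apply: (@le_trans _ _ (Num.sqrt (2 * qT T * l))).
    rewrite /norm_b -/l lerBlDr lerDl divr_ge0 ?mulr_ge0 ?sqrtr_ge0 //.
    rewrite subr_ge0 ler_ln ?posrE //; lra.
  rewrite -sqrtrM; last by lra.
  apply: ler_wsqrtr; rewrite -(mulrA 2 (qT T)) -(mulrA 2 (D + 1)) ler_pM2l //.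
  by apply: le_trans l2; rewrite ler_piMl // ltW.
by rewrite mulrDl lerD.
Qed.

(** This is [1 + y <= expR y] at [y = C * ln m]. It brings polynomial error rates to the scale
    [1 / ln m] of the Chebyshev bounds. *)
Lemma powRN_le_lnV (m : nat) (C : R) : 0 < C -> 0 < ln m%:R :> R ->
  m%:R `^ (- C) <= (C * ln m%:R)^-1 :> R.
Proof.
move=> C0 L0.
have m0 : m%:R != 0 :> R.
  by apply/eqP => e; move: L0; rewrite e ln0 ?ltxx.
have CL : 0 < C * ln m%:R :> R by rewrite mulr_gt0.
rewrite powRN /powR (negPf m0) lef_pV2 ?posrE ?expR_gt0 //.
by apply: le_trans (expR_ge1Dx _); lra.
Qed.

End deterministic_bounds.

(** * The location model *)

Section location_model.
Context {R : realType} {dO dS : measure_display}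
  {Omega : measurableType dO} {S : measurableType dS}.
Variable P : probability Omega R.
Variables (eps : int -> Omega -> S) (eps0' : Omega -> S).
Variable g : nat -> (nat -> S) -> R.
Let e := err g eps.
Hypothesis iidZ : iid P (with_copy eps eps0').
Hypothesis mg : forall h, (0 < h)%N -> measurable_on_sequences (g h).
Hypothesis centered : forall (t : int) h, (0 < h)%N ->
  P.-integrable setT (EFin \o e t h) /\ ('E_P[e t h] = 0)%E.
Variables (mu : int -> nat -> R) (p beta0 C : R).
Hypotheses (p4 : 4 <= p) (beta0_ge0 : 0 <= beta0) (beta0_lt1 : beta0 < 1).
Hypothesis C0 : 0 < C.
Hypothesis finite_norm : forall (t : int) h, (0 < h)%N ->
  ('N[P]_(p%:E)[EFin \o e t h] < +oo)%E.
Hypothesis dependence : forall t h : nat, (0 < h)%N ->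
  (vartheta P p (location mu e) (location mu (err_copy g eps eps0')) t%:Z h <=
   (C * beta0 ^+ t)%:E)%E.

(* A positive rate, since the scaling in [Lnorm_square_le] divides by it. *)
Definition rate : R := Num.max beta0 (1 / 2).

(** The constant of [covariance_decay] for [c = 2 * C ^+ 2], the factor 2 coming from
    [Lnorm_square_le]. *)
Definition cov_const : R := 2 * C ^+ 2 / 2 / (1 - rate ^+ 2).

Lemma rate01 : 0 < rate < 1.
Proof.
rewrite /rate lt_max gt_max beta0_lt1 /=; apply/andP; split; last by lra.
by apply/orP; right; lra.
Qed.

Lemma cov_const_ge0 : 0 <= cov_const.
Proof.
have /andP[r0 r1] := rate01.
have r2 : 0 <= 1 - rate ^+ 2 by rewrite subr_ge0 ltW // expr_lt1 // ltW.
by apply: divr_ge0 r2; rewrite divr_ge0 // mulr_ge0 // sqr_ge0.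
Qed.

Lemma err_measurable t h : (0 < h)%N -> measurable_fun setT (e t h).
Proof. by move=> h0; case: (centered t h0) => /integrableP[/measurable_EFinP]. Qed.

Lemma err_mean t h : (0 < h)%N -> \int[P]_o e t h o = 0.
Proof. by move=> /(centered t)[_]; rewrite unlock /Rintegral => ->. Qed.

Lemma err_square t h : (0 < h)%N -> rv_integrable P (fun o => e t h o ^+ 2).
Proof.
move=> h0; have me := err_measurable t h0.
apply: rv_square_integrable_fourth => //.
exact: Lnorm_fourth_integrable p4 me (finite_norm t h0).
Qed.

Lemma err_cov h (tau : int) (t : nat) : (0 < h)%N ->
  `|\int[P]_o (e tau h o * e (tau + t%:Z) h o)| <= cov_const * rate ^+ t.
Proof.
move=> h0; have me t' := err_measurable t' h0; have /andP[r0 _] := rate01.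
apply: (covariance_decay iidZ (mg h0) _ _ rate01).
- exact: Lnorm_fourth_integrable p4 (me 0) (finite_norm 0 h0).
- exact: (err_mean 0 h0).
- move=> s.
  have k0 : 0 < C * rate ^+ s by rewrite mulr_gt0 // exprn_gt0.
  have -> : 2 * C ^+ 2 * (rate ^+ s) ^+ 2 = 2 * (C * rate ^+ s) ^+ 2 by ring.
  apply: (Lnorm_square_le p4 k0).
    apply: measurable_funB; first exact: me.
    rewrite (_ : (fun x => _) = fun o => g h (fun i => with_copy eps eps0'
      (if s%:Z - i%:Z == 0 then None else Some (s%:Z - i%:Z)) o)).
      exact: (functional_measurable iidZ _ (mg h0)).
    by apply/funext => o; rewrite past_copyE.
  (* The means cancel in the coupling distance, and [beta0] is at most [rate]. *)
  apply: (@le_trans _ _ (C * beta0 ^+ s)%:E).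
    apply: le_trans (dependence s h0); rewrite le_eqVlt; apply/orP; left.
    apply/eqP/eq_Lnorm => o; rewrite /= /location /e /err /err_copy; congr EFin.
    by ring.
  rewrite lee_fin ler_pM2l // lerXn2r ?nnegrE ?(ltW r0) //.
  by rewrite /rate le_max lexx.
Qed.

(** A negative lag is a positive lag started from the earlier time; [err_cov] holds from every
    starting time. *)
Lemma err_cov_int h (t : int) : (0 < h)%N ->
  `|\int[P]_o (e 0 h o * e t h o)| <= cov_const * rate ^+ `|t|%N.
Proof.
move=> h0; case: t => n; first by have := err_cov 0 n h0; rewrite add0r.
have := err_cov (Negz n) n.+1 h0.
rewrite (_ : Negz n + n.+1%:Z = 0); last by lia.
by congr (`|_| <= _); apply: eq_Rintegral => o _; rewrite mulrC.
Qed.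

Lemma covariance_location h (t : int) : (0 < h)%N ->
  covariance P (location mu e 0 h) (location mu e t h) =
  (\int[P]_o (e 0 h o * e t h o))%:E.
Proof.
move=> h0; have E t' : fine 'E_P[location mu e t' h] = mu t' h.
  have [it _] := centered t' h0.
  rewrite unlock -[LHS]/(\int[P]_o (mu t' h + e t' h o)) rv_expectD //.
    by rewrite rv_expect_cst err_mean // addr0.
  exact: rv_integrable_cst.
rewrite unlock !E unlock /Rintegral fineK; last first.
  apply: integrable_fin_num => //.
  by apply: rv_integrable_prod; try exact: err_measurable; exact: err_square.
apply: eq_integral => o _; congr EFin.
transitivity ((mu 0 h + e 0 h o - mu 0 h) * (mu t h + e t h o - mu t h)).
  by [].
by ring.
Qed.

(** A bound uniform in the component; it caps the estimated scale in the denominator of the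
    statistic. *)
Lemma lr_sd_le h : (0 < h)%N ->
  lr_sd P (location mu e) h <= Num.sqrt (2 * cov_const / (1 - rate)).
Proof.
move=> h0; apply: ler_wsqrtr; apply: sumZ_le cov_const_ge0 rate01 _ => t.
rewrite covariance_location // lee_fin (le_trans (ler_norm _)) //.
exact: err_cov_int.
Qed.

Lemma err_sum_deviation h (s n : nat) (l : R) : (0 < h)%N -> 0 < l ->
  (P [set o | (l < `|\sum_(i < n) e (s + i)%N%:Z h o|)%R] <=
   (n%:R * (2 * cov_const / (1 - rate)) / l ^+ 2)%:E)%E.
Proof.
move=> h0 l0.
apply: (@partial_sum_deviation _ _ _ P (fun i : nat => e (s + i)%N%:Z h)
  cov_const rate rate01 _ _ _ n l l0).
- by move=> i; exact: err_measurable.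
- by move=> i; exact: err_square.
- move=> i t; have := err_cov (s + i)%N%:Z t h0.
  by rewrite -PoszD addnA.
Qed.

Lemma location_measurable t h : (0 < h)%N -> measurable_fun setT (location mu e t h).
Proof. by move=> h0; apply: measurable_funD => //; exact: err_measurable. Qed.

Lemma sample_mean_location h (i n : nat) w (b : R) :
  (0 < n)%N -> (forall t : nat, (i <= t < i + n)%N -> mu t%:Z h = b) ->
  sample_mean (location mu e) i (i + n).-1 h w =
  b + (\sum_(k < n) e (i + k)%N%:Z h w) / n%:R.
Proof.
move=> n0 hb; rewrite /sample_mean prednK ?addn_gt0 ?n0 ?orbT //.
rewrite addKn.
have -> : \sum_(i <= t < i + n) location mu e t%:Z h w =
    \sum_(t < n) (b + e (i + t)%N%:Z h w).
  rewrite -{1}(add0n i) big_addn addKn big_mkord.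
  apply: eq_bigr => t _; rewrite /location addnC hb //.
  by rewrite leq_addr ltn_add2l ltn_ord.
have nR : n%:R != 0 :> R by rewrite pnatr_eq0 -lt0n.
by rewrite big_split /= sumr_const card_ord mulrDl -[b *+ n]mulr_natr mulfK.
Qed.

Lemma mean_vec_component (n t t' h : nat) : (1 <= h <= n)%N ->
  mean_vec mu n t = mean_vec mu n t' -> mu t%:Z h = mu t'%:Z h.
Proof.
case: h => [|h] // /andP[_ hn] /(congr1 (fun v : 'rV[R]_n => v 0 (Ordinal hn))).
by rewrite !mxE.
Qed.

(** Union bound over three failures: [B], where the scale estimate is unreliable, and a large
    deviation of the error sum in either window. The windows have at most [(1 + T) * m] and [T * m]
    terms, whence the two variance factors; [k <= (T - c) * m] leaves at least [c * m] terms after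
    the change. *)
Lemma detection_probability (shat : nat -> Omega -> R) (m n Tm k h : nat)
    (T c l smax thr x0 : R) (B : set Omega) :
  (0 < m)%N -> 0 < T -> Tm%:R = T * m%:R -> (1 <= h <= n)%N ->
  mean_change mu m n Tm k ->
  0 < c -> k%:R <= (T - c) * m%:R ->
  (forall i, (1 <= i <= n)%N -> measurable_fun setT (shat i)) ->
  0 < l ->
  measurable B -> (P B <= x0%:E)%E ->
  (forall w, ~ B w -> 0 < shat h w <= smax) ->
  let Q := c * (Num.sqrt m%:R *
    `|mu (m + k - 1)%N%:Z h - mu (m + k)%N%:Z h|) - (1 + T) * l in
  0 <= Q -> thr < Q / ((1 + T) * smax) ->
  ((1 - (x0 + ((1 + T) * (2 * cov_const / (1 - rate)) / l ^+ 2 +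
         T * (2 * cov_const / (1 - rate)) / l ^+ 2)))%:E <=
   P [set w | (thr%:E < max_stat (location mu e) shat m n Tm w)%E])%E.
Proof.
move=> m0 T0 TmE hn [/andP[k1 kT] pre post _] c0 kc mshat l0 mB PB Bs Q Q0 thrQ.
have h0 : (0 < h)%N by case/andP: hn.
set V := 2 * cov_const / (1 - rate).
have V0 : 0 <= V.
  have /andP[_ r1] := rate01.
  have r2 : 0 <= 1 - rate by rewrite subr_ge0 ltW.
  by apply: divr_ge0 r2; rewrite mulr_ge0 // cov_const_ge0.
set M : R := m%:R; have M0 : 0 < M by rewrite ltr0n.
have rM0 : 0 < Num.sqrt M by rewrite sqrtr_gt0.
(* The windows split exactly at the change: times [1] to [m + k - 1], then [m + k] to [m + Tm]. *)
pose n1 := (m + k.-1)%N; pose n2 := (Tm - k.-1)%N.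
pose S1 w := \sum_(i < n1) e (1 + i)%N%:Z h w.
pose S2 w := \sum_(i < n2) e (m + k + i)%N%:Z h w.
set thr_event := [set w | _].
pose B1 := [set w | l * Num.sqrt M < `|S1 w|].
pose B2 := [set w | l * Num.sqrt M < `|S2 w|].
have n1E : n1%:R = M + k.-1%:R by rewrite natrD.
have n2E : n2%:R = T * M - k.-1%:R.
  by rewrite natrB ?TmE // (leq_trans (leq_pred _)).
have kE : k.-1%:R = k%:R - 1 :> R by rewrite -[in RHS](prednK k1) -natr1 addrK.
have kTR : k%:R <= T * M by rewrite -TmE ler_nat.
have k1R : 0 <= k.-1%:R :> R by [].
have lM0 : 0 < l * Num.sqrt M by rewrite mulr_gt0.
have lM2 : (l * Num.sqrt M) ^+ 2 = l ^+ 2 * M by rewrite exprMn sqr_sqrtr // ltW.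
have PS s0 nn (C1 : R) : nn%:R <= C1 * M ->
  (P [set w | (l * Num.sqrt M < `|\sum_(i < nn) e (s0 + i)%N%:Z h w|)%R] <=
   (C1 * V / l ^+ 2)%:E)%E.
  move=> hC; apply: (le_trans (err_sum_deviation s0 nn h0 lM0)).
  rewrite lee_fin -/V lM2 ler_pdivrMr ?mulr_gt0 ?exprn_gt0 //.
  rewrite (_ : C1 * V / l ^+ 2 * (l ^+ 2 * M) = C1 * M * V).
    by rewrite ler_wpM2r.
  by field; rewrite gt_eqF.
have P1 : (P B1 <= ((1 + T) * V / l ^+ 2)%:E)%E.
  by apply: PS; rewrite n1E; lra.
have P2 : (P B2 <= (T * V / l ^+ 2)%:E)%E by apply: PS; rewrite n2E; lra.
have mS s0 nn : measurable [set w | l * Num.sqrt M <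
    `|\sum_(i < nn) e (s0 + i)%N%:Z h w|].
  rewrite (_ : [set w | _] = (fun w => `|\sum_(i < nn) e (s0 + i)%N%:Z h w|)
      @^-1` `]l * Num.sqrt M, +oo[); last first.
    by apply/seteqP; split => o; rewrite /= in_itv /= andbT.
  rewrite -[X in measurable X]setTI.
  have ms : measurable_fun setT (fun w => \sum_(i < nn) e (s0 + i)%N%:Z h w).
    by apply: measurable_sum => i; exact: err_measurable.
  by apply: (measurableT_comp (@normr_measurable R setT) ms) => //; exact: measurable_itv.
have mX t i : (0 < i)%N -> measurable_fun setT (location mu e t i).
  exact: location_measurable.
have mA : measurable thr_event.
  rewrite -[X in measurable X]setTI.
  apply: emeasurable_fun_o_infty => //.
  exact: max_stat_measurable.
have good w : ~ B w -> ~ B1 w -> ~ B2 w -> thr_event w.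
  move=> /Bs /andP[s0 ss] /negP; rewrite -leNgt => h1 /negP; rewrite -leNgt => h2.
  have kk : (k.-1 < k)%N by rewrite ltn_predL.
  have TT : (1 <= Tm <= Tm)%N by rewrite leqnn andbT (leq_trans k1).
  have jT : (k.-1 < Tm)%N by rewrite (leq_trans kk).
  have n20 : (0 < n2)%N by rewrite subn_gt0.
  have n10 : (0 < n1)%N by rewrite addn_gt0 m0.
  have e1 : sample_mean (location mu e) 1 (m + k.-1) h w =
      mu (m + k - 1)%N%:Z h + S1 w / n1%:R.
    apply: (@sample_mean_location h 1 n1 w) => // t /andP[t1 t2].
    apply: (@mean_vec_component n t (m + k - 1) h hn).
    have r1 : (1 <= t <= m + k - 1)%N by move: t1 t2; rewrite /n1; clear -k1; lia.
    have r2 : (1 <= m + k - 1 <= m + k - 1)%N by clear -k1 m0; lia.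
    by rewrite (pre _ r1) (pre _ r2).
  have e2 : sample_mean (location mu e) (m + k.-1 + 1) (m + Tm) h w =
      mu (m + k)%N%:Z h + S2 w / n2%:R.
    have -> : (m + k.-1 + 1 = m + k)%N by clear -k1; lia.
    have -> : (m + Tm = (m + k + n2).-1)%N by rewrite /n2; clear -k1 kT; lia.
    apply: sample_mean_location => // t /andP[t1 t2].
    apply: (@mean_vec_component n t (m + k) h hn).
    have r1 : (m + k <= t <= m + Tm)%N by move: t1 t2; rewrite /n2; clear -k1 kT; lia.
    exact: post r1.
  have := max_stat_ge (location mu e) shat m w TT hn jT.
  rewrite e1 e2 /thr_event /=; apply: lt_le_trans; rewrite lte_fin.
  apply: (lt_le_trans thrQ).
  have -> : Tm%:R / m%:R = T by rewrite TmE mulfK // gt_eqF.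
  have -> : mu (m + k)%N%:Z h + S2 w / n2%:R - (mu (m + k - 1)%N%:Z h + S1 w / n1%:R) =
    mu (m + k)%N%:Z h - mu (m + k - 1)%N%:Z h + S2 w / n2%:R - S1 w / n1%:R by ring.
  rewrite /Q distrC; apply: (@signal_minus_noise _ M T _ _ _ _ _ _ smax l c) => //.
  - by rewrite n1E; lra.
  - by rewrite n2E kE; lra.
  - by rewrite n2E; lra.
  - by rewrite distrC.
have sub : ~` thr_event `<=` B `|` (B1 `|` B2).
  move=> w nA; apply: contrapT => /not_orP[nB /not_orP[nB1 nB2]].
  by apply: nA; exact: good.
have m1 : measurable B1 by exact: mS.
have m2 : measurable B2 by exact: mS.
have m12 : measurable (B1 `|` B2) by exact: measurableU.
have : (P (~` thr_event) <= (x0 + ((1 + T) * V / l ^+ 2 + T * V / l ^+ 2))%:E)%E.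
  apply: (@le_trans _ _ (P (B `|` (B1 `|` B2)))).
    apply: le_measure => //; rewrite inE; first exact: measurableC.
    exact: measurableU.
  apply: (le_trans (measureU2 _ _ _)) => //; rewrite EFinD leeD //.
  by apply: (le_trans (measureU2 _ _ _)) => //; rewrite EFinD leeD.
rewrite probability_setC // -(fineK (fin_num_measure P _ mA)).
rewrite -EFinB !lee_fin => hh; lra.
Qed.

End location_model.

(** * Passage to the limit *)

Section asymptotics.
Context {R : realType} {dO : measure_display} {Omega : measurableType dO}.
Variable P : probability Omega R.

Lemma ln_nat_near (F : set_system nat) (L : R) : \oo `<=` F ->
  F [set m | L <= ln m%:R].
Proof.
move=> oF; apply: oF; exists (Num.truncn (expR L)).+1 => // m /= hm.
have h : expR L <= m%:R.
  by apply: (le_trans (ltW (truncnS_gt _))); rewrite ler_nat.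
have m0 : 0 < m%:R :> R by exact: lt_le_trans (expR_gt0 _) h.
by rewrite -[L]expRK ler_ln // posrE ?expR_gt0.
Qed.

(** The probabilities are squeezed between [1 - W / ln m] and 1. *)
Lemma probability_cvg1 (F : set_system nat) (A : nat -> set Omega) (W : R) :
  Filter F -> \oo `<=` F -> F [set m | measurable (A m)] ->
  F [set m | ((1 - W / ln m%:R)%:E <= P (A m))%E] ->
  (fun m => P (A m)) @ F --> 1%E.
Proof.
move=> FF oF mA lb; apply/fine_cvgP; split.
  by apply: (@filterS _ F FF _ _ _ mA) => m; exact: fin_num_measure.
apply/cvgrPdist_le => e e0.
have := ln_nat_near (1 + `|W| / e) oF.
apply: filterS3 mA lb => m /= mA lb hL.
have L0 : 0 < ln m%:R :> R.
  by apply: lt_le_trans hL; rewrite ltr_pwDl // divr_ge0 // ltW.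
have WL : W / ln m%:R <= e.
  rewrite ler_pdivrMr // (le_trans (ler_norm W)) // -ler_pdivrMl // mulrC.
  by apply: le_trans hL; rewrite lerDr.
have Pf := fineK (fin_num_measure P _ mA).
rewrite -Pf lee_fin in lb.
have : fine (P (A m)) <= 1 by rewrite -lee_fin Pf probability_le1.
by move=> le1; rewrite ler_norml; apply/andP; split; lra.
Qed.

Lemma limf_esup_ltP (F : set_system nat) (f : nat -> R) (T : R) : Filter F ->
  (limf_esup (fun m => (f m)%:E) F < T%:E)%E ->
  exists2 c : R, 0 < c & F [set m | f m <= T - c].
Proof.
move=> FF /ereal_inf_lt[_ [V FV <-]].
set s := ereal_sup _; case E : s => [r| |] //.
  rewrite lte_fin => rT; exists (T - r); first by rewrite subr_gt0.
  apply: (filterS _ FV) => m Vm; rewrite /= subKr -lee_fin -E.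
  by apply: ereal_sup_ubound; exists m.
(* A supremum equal to [-oo] forces [V] to be empty, so any positive constant serves. *)
move=> _; exists 1 => //; apply: (filterS _ FV) => m Vm.
have : ((f m)%:E <= s)%E by apply: ereal_sup_ubound; exists m.
by rewrite E leeNy_eq.
Qed.

Lemma near_sd_bounds (y s t c v : R) : `|y - s| < t -> t <= 1 -> t <= c / 2 ->
  0 < c -> c <= s -> s <= v -> 0 < y <= v + 1.
Proof.
rewrite ltr_norml => /andP[h1 h2] h3 h4 h5 h6 h7.
by apply/andP; split; lra.
Qed.

(** The required size of [r * Delta] makes [Q] exceed [(1 + T) * smax * x * sL] by at least a full
    [sL], which gives the strict inequality. In the application [sL] is [sqrt (ln m)], both the
    noise level and the order of the threshold. *)
Lemma detection_margin (T smax x c r sL Delta t : R) :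
  0 < T -> 0 < smax -> 0 <= x -> 0 < c -> 0 < sL -> t <= x * sL ->
  ((1 + T) + (1 + T) * smax * x + 1) / c <= r * Delta ->
  let Q := c * (r * sL * Delta) - (1 + T) * sL in
  0 <= Q /\ t < Q / ((1 + T) * smax).
Proof.
move=> T0 s0 x0 c0 sL0 tx; rewrite ler_pdivrMr // => h Q.
have T10 : 0 < 1 + T by rewrite addr_gt0.
have y0 : 0 <= (1 + T) * smax * x by rewrite !mulr_ge0 // ltW.
have Qge : ((1 + T) * smax * x + 1) * sL <= Q.
  by rewrite -(ler_pM2r sL0) in h; rewrite /Q; lra.
split; first by apply: le_trans Qge; rewrite mulr_ge0 ?(ltW sL0) // addr_ge0.
rewrite ltr_pdivlMr ?mulr_gt0 //; apply: lt_le_trans Qge.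
apply: (@le_lt_trans _ _ (x * sL * ((1 + T) * smax))).
  by rewrite ler_pM2r // mulr_gt0.
by rewrite -subr_gt0 (_ : _ - _ = sL) //; ring.
Qed.

End asymptotics.

Theorem theorem3p10
  (R : realType) (dO dS : measure_display)
  (Omega : measurableType dO) (P : probability Omega R)
  (S : measurableType dS)
  (eps : int -> Omega -> S) (eps0' : Omega -> S)
  (g : nat -> (nat -> S) -> R)
  (mu : nat -> int -> nat -> R)
  (T : R) (d : nat -> nat)
  (sd_est : forall m : nat, nat -> m.-tuple ((d m).-tuple R) -> R)
  (D : R) (kstar hstar : nat -> nat) (alpha : R) :
  let e := err g eps in
  let X m := location (mu m) e in
  let X' m := location (mu m) (err_copy g eps eps0') in
  let shat m h w := sd_est m h (initial_sample (X m) m (d m) w) in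
  0 < T ->
  (* location model *)
  iid P (with_copy eps eps0') ->
  (forall h, (0 < h)%N -> measurable_on_sequences (g h)) ->
  (forall (t : int) h, (0 < h)%N ->
     P.-integrable setT (EFin \o e t h) /\ ('E_P[e t h] = 0)%E) ->
  (* (D1) *)
  (0 < D /\ exists2 C_D : R, 0 < C_D &
     forall m, sample_size T m ->
       m%:R `^ (C_D^-1) <= (d m)%:R <= C_D * m%:R `^ D) ->
  (* (S1) *)
  (exists (Bs : nat -> R) (B C_e : R),
     [/\ B < 3 / 8, 1 < C_e &
         forall m, sample_size T m ->
           0 < Bs m <= m%:R `^ B /\
           forall h, (1 <= h <= d m)%N ->
             ('E_P[(fun w => expR (`|e 1 h w| / Bs m))%R] <= C_e%:E)%E]) ->
  (* (TD1) *)
  (exists p beta C_theta : R,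
     [/\ 2 * D + 4 < p, 0 <= beta < 1, 0 < C_theta,
         forall (t : int) h, (0 < h)%N -> ('N[P]_(p%:E)[EFin \o e t h] < +oo)%E &
         forall m, sample_size T m -> forall (t h : nat), (0 < h)%N ->
           (vartheta P p (X m) (X' m) t%:Z h <= (C_theta * beta ^+ t)%:E)%E]) ->
  (* (TD2) *)
  (exists2 c_sigma : R, 0 < c_sigma &
     forall m, sample_size T m -> forall h, (0 < h)%N ->
       c_sigma <= lr_sd P (X m) h) ->
  (* (SD1) *)
  (exists2 r : nat -> R, r @ \oo --> (0 : R) &
     forall m, sample_size T m -> forall i j, (0 < i)%N -> (0 < j)%N ->
       (2 <= `|i%:Z - j%:Z|)%N ->
       `|lr_corr P (X m) i j| <=
         (ln (`|i%:Z - j%:Z|%N)%:R) ^- 2 * r `|i%:Z - j%:Z|%N) ->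
  (* (SD2) *)
  (exists2 rho_plus : R, 0 <= rho_plus < 1 &
     forall m, sample_size T m -> forall i j, (0 < i)%N -> (0 < j)%N ->
       (1 <= `|i%:Z - j%:Z|)%N -> `|lr_corr P (X m) i j| <= rho_plus) ->
  (* (V) *)
  (forall m, sample_size T m -> forall h, (1 <= h <= d m)%N ->
     measurable_fun setT (sd_est m h)) ->
  (exists c_s C_s delta_s : R,
     [/\ 0 < c_s, 0 < C_s, 0 < delta_s &
         forall m, sample_size T m ->
           (P [set w | ((m%:R `^ (- delta_s))%:E <=
                        max_sd_error (shat m) (lr_sd P (X m)) (d m) w)%E]
            <= (c_s * m%:R `^ (- C_s))%:E)%E]) ->
  (* H_1 with change time [kstar m] *)
  (forall m, sample_size T m ->
     mean_change (mu m) m (d m) (horizon T m) (kstar m)) ->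
  (* the component [hstar m] with a sufficiently large change *)
  (\forall m \near m_to_infty T, (1 <= hstar m <= d m)%N) ->
  (fun m => Num.sqrt (m%:R / ln m%:R) *
     `|mu m (m + kstar m - 1)%N%:Z (hstar m)
       - mu m (m + kstar m)%N%:Z (hstar m)|) @ m_to_infty T --> +oo ->
  (limf_esup (fun m => ((kstar m)%:R / m%:R)%:E) (m_to_infty T) < T%:E)%E ->
  0 < alpha < 1 ->
  (fun m => P [set w |
     ((quantile gumbel_cdf (1 - alpha) / norm_a T (d m) + norm_b T (d m))%:E
      < max_stat (X m) (shat m) m (d m) (horizon T m) w)%E])
    @ m_to_infty T --> 1%E.
Proof.
move=> e X X' shat T0 iidZ mg cent [D0 [C_D CD0 hD]] _ TD1 [cs cs0 TD2] _ _ msd.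
move=> [c_s [C_s [del [c_s0 C_s0 del0 hV]]]] H1 hh sig kT _.
have [p [beta [C [p4' /andP[beta0 beta1] C0 fn dep]]]] := TD1.
have p4 : 4 <= p by lra.
pose thr m := quantile gumbel_cdf (1 - alpha) / norm_a T (d m) + norm_b T (d m).
have FF : Filter (m_to_infty T) by exact: within_filter.
have oF : \oo `<=` m_to_infty T by move=> A; apply: filterS => m Am _.
have [c c0 kc] := limf_esup_ltP FF kT.
(* [V] bounds the long-run variances and, per term, the variances of error sums; [smax] caps the
   scale estimate on the good event; [x] bounds the threshold in units of [sqrt (ln m)]; [B] is the
   signal that [detection_margin] asks for; [W] collects the error of (V) and the two Chebyshev
   bounds. *)
pose V := 2 * cov_const beta C / (1 - rate beta).
pose smax := Num.sqrt V + 1.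
pose x := `|quantile gumbel_cdf (1 - alpha)| + Num.sqrt (2 * (D + 1)).
pose B := ((1 + T) + (1 + T) * smax * x + 1) / c.
pose W := c_s / C_s + ((1 + T) * V + T * V).
have smax0 : 0 < smax by rewrite ltr_wpDl // sqrtr_ge0.
have x0 : 0 <= x by rewrite addr_ge0 // sqrtr_ge0.
have mX m t h : (0 < h)%N -> measurable_fun setT (X m t h).
  exact: (location_measurable cent (mu m) t).
have mshat m : sample_size T m -> forall h, (1 <= h <= d m)%N ->
    measurable_fun setT (shat m h).
  move=> sm h hd; apply: (measurableT_comp (msd m sm h hd)).
  by apply: initial_sample_measurable => t i; exact: mX.
have ss : \forall m \near m_to_infty T, sample_size T m by exact: near_withinT.
apply: (@probability_cvg1 _ _ _ P (m_to_infty T) _ W) => //.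
  apply: filterS ss => m sm /=; rewrite -[X in measurable X]setTI.
  apply: emeasurable_fun_o_infty => //.
  by apply: max_stat_measurable; [exact: mX|exact: mshat].
have sigB := (cvgryPge _).1 sig B.
(* All summands are nonnegative, so one lower bound on [ln m] yields each requirement separately.
   The last two summands make [m] to the power [- del] at most [cs / 2] and at most 1. *)
have L1 := ln_nat_near (1 + `|ln C_D| + C_D * (1 + 16 / pi) +
  2 / (del * cs) + del^-1) oF.
near=> m.
have sm : sample_size T m by near: m.
have hd : (1 <= hstar m <= d m)%N by near: m.
have hk : (kstar m)%:R / m%:R <= T - c by near: m.
have hB : B <= Num.sqrt (m%:R / ln m%:R) *
    `|mu m (m + kstar m - 1)%N%:Z (hstar m) - mu m (m + kstar m)%N%:Z (hstar m)|.
  by near: m; exact: sigB.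
have hL : 1 + `|ln C_D| + C_D * (1 + 16 / pi) + 2 / (del * cs) + del^-1 <=
    ln m%:R by near: m; exact: L1.
case: (sm) => m0 Tnat; have M0 : 0 < m%:R :> R by rewrite ltr0n.
have pi0 : 0 < pi :> R := pi_gt0 R.
have a1 : 0 <= C_D * (1 + 16 / pi).
  by rewrite mulr_ge0 ?(ltW CD0) // addr_ge0 // divr_ge0 // ltW.
have a2 : 0 <= 2 / (del * cs) by rewrite divr_ge0 // mulr_ge0 // ltW.
have a3 : 0 <= del^-1 by rewrite invr_ge0 ltW.
have a4 := ler_norm (ln C_D); have a5 := normr_ge0 (ln C_D).
set L : R := ln m%:R in hL hB *.
have L0 : 0 < L by lra.
have L1' : 1 <= L by lra.
have L2 : ln C_D <= L by lra.
have L3 : C_D * (1 + 16 / pi) <= L by lra.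
have L4 : 2 / (del * cs) <= L by lra.
have L5 : del^-1 <= L by lra.
have rL0 : 0 < Num.sqrt L by rewrite sqrtr_gt0.
have rL2 : Num.sqrt L ^+ 2 = L by rewrite sqr_sqrtr // ltW.
have small : m%:R `^ (- del) <= (del * L)^-1 by exact: powRN_le_lnV.
have small1 : m%:R `^ (- del) <= 1.
  apply: (le_trans small); by rewrite invf_le1 ?mulr_gt0 // -ler_pdivrMl // mulr1.
have small2 : m%:R `^ (- del) <= cs / 2.
  apply: (le_trans small); rewrite -[leRHS]invf_div lef_pV2 ?posrE ?divr_gt0 ?mulr_gt0 //.
  by move: L4; rewrite !ler_pdivrMr ?mulr_gt0 // mulrCA mulrA.
have h0 : (0 < hstar m)%N by case/andP: hd.
have sdle : lr_sd P (X m) (hstar m) <= Num.sqrt V.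
  exact: (lr_sd_le iidZ mg cent p4 beta0 beta1 C0 fn (dep m sm) h0).
have sdge := TD2 m sm _ h0.
pose bad := [set w | ((m%:R `^ (- del))%:E <=
  max_sd_error (shat m) (lr_sd P (X m)) (d m) w)%E].
have mbad : measurable bad.
  rewrite -[X in measurable X]setTI; apply: emeasurable_fun_c_infty => //.
  by apply: max_sd_error_measurable; exact: mshat.
have badE w : ~ bad w -> 0 < shat m (hstar m) w <= smax.
  move=> /negP; rewrite -ltNge => hw.
  have := le_lt_trans (max_sd_error_ge (shat m) (lr_sd P (X m)) w hd) hw.
  by rewrite lte_fin => near_sd;
    exact: near_sd_bounds near_sd small1 small2 cs0 sdge sdle.
have kc' : (kstar m)%:R <= (T - c) * m%:R by rewrite -ler_pdivrMr.
have thrle : thr m <= x * Num.sqrt L.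
  apply: (threshold_le _ T0 D0 CD0); rewrite -/L //.
  exact: hD.
(* The assumed divergence concerns [sqrt (m / ln m)] times the jump; the spare factor [sqrt (ln m)]
   beats both noise and threshold. *)
have rM : Num.sqrt m%:R = Num.sqrt (m%:R / L) * Num.sqrt L.
  by rewrite -sqrtrM ?divr_ge0 ?(ltW L0) // divfK // gt_eqF.
have [] := detection_margin T0 smax0 x0 c0 rL0 thrle hB.
rewrite -rM => Q0 thrlt.
(* The truncation is exact at admissible sample sizes. *)
have TmE : (horizon T m)%:R = T * m%:R by rewrite /horizon truncnK.
have := detection_probability iidZ mg cent p4 beta0 beta1 C0 fn (dep m sm)
  m0 T0 TmE hd (H1 m sm) c0 kc' (mshat m sm) rL0 mbad (hV m sm) badE Q0 thrlt.
apply: le_trans; rewrite lee_fin lerD2l lerN2 -/V rL2.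
have : c_s * m%:R `^ (- C_s) <= c_s / C_s / L.
  apply: (@le_trans _ _ (c_s * (C_s * L)^-1)).
    by rewrite ler_pM2l //; exact: powRN_le_lnV.
  by rewrite invfM mulrA.
by move=> h; rewrite /W [leRHS]mulrDl lerD // -mulrDl.
Unshelve. all: by end_near.
Qed.
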